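(* Let $\mathbb{F}_\ell$ be a finite field, $n\ge1$ an integer, and let $p:\underline{\mathfrak g}=\mathfrak{gl}_n\to\underline{\mathfrak c}$ be the Chevalley map over $\mathbb{F}_\ell$. For $i\in\mathbb{N}$ let $\underline{\mathfrak g}_i=\underline{\mathfrak g}\times_{\underline{\mathfrak c}}\cdots\times_{\underline{\mathfrak c}}\underline{\mathfrak g}$ ($i$ times), the fiber product being taken with respect to $p$. For every $i$ there is a constant $C_i$ such that for every $m\in\mathbb{N}$ $$\dim \mathcal{J}_m(\underline{\mathfrak g}_i)<m\dim(\underline{\mathfrak g}_i)+C_i .$$
   Context: All varieties are over $\mathbb{F}_\ell$. $\mathfrak{gl}_n$ is the variety of $n\times n$ matrices; $\underline{\mathfrak c}\cong\mathbb{A}^n$ is the affine space of monic polynomials of degree $n$; $p$ sends a matrix to its characteristic polynomial. $\mathcal{J}_m(\mathbf{X})$ denotes the $m$-th jet scheme of $\mathbf{X}$ (representing $A\mapsto\mathbf{X}(A[t]/(t^{m+1}))$). *)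

(* Defs.v *)
From HB Require Import structures.
From mathcomp Require Import all_boot all_order all_algebra.
From mathcomp Require Import ring_quotient qpoly.
From mathcomp Require Import mpoly.

Set Implicit Arguments.
Unset Strict Implicit.
Unset Printing Implicit Defensive.

Import GRing.Theory.
Local Open Scope ring_scope.

(** An affine scheme of finite type over [k] is given as the closed subscheme
    of the affine space with coordinates indexed by a finite type [T] that is
    cut out by a finite list of polynomials. It is not assumed to be reduced:
    its coordinate ring is [k[x_t : t in T]] modulo the ideal generated by the
    list. *)

Section AffineSchemes.
Variable k : comNzRingType.
Implicit Types S T K : finType.

Definition fpoly T := {mpoly k[#|T|]}.

Definition var T (t : T) : fpoly T := 'X_(enum_rank t).

Definition affine_scheme T := seq (fpoly T).

(** [f] evaluated at [v] in a [k]-algebra [B] with structure map [phi] *)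
Definition ev T (B : comNzRingType) (phi : {rmorphism k -> B}) (v : T -> B)
  (f : fpoly T) : B := mmap phi (v \o enum_val) f.

(** [v] is a [B]-valued point of [X] *)
Definition is_point T (X : affine_scheme T) (B : comNzRingType)
  (phi : {rmorphism k -> B}) (v : T -> B) : Prop :=
  forall f, f \in X -> ev phi v f = 0.

(** A chain of [d] strict inclusions between prime ideals of the coordinate
    ring of [X], i.e. between primes of the polynomial ring containing the
    equations of [X] ([idealr_closed] ideals are proper). Ideals are boolean
    predicates, which is no restriction classically. *)
Definition prime_chain T (X : affine_scheme T) (d : nat) : Prop :=
  exists P : 'I_d.+1 -> {pred fpoly T},
    (forall a, [/\ idealr_closed (P a), prime_idealr_closed (P a)
                 & {subset X <= P a}])
    /\ (forall a b : 'I_d.+1, (a < b)%N ->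
          {subset P a <= P b} /\ exists2 f, f \in P b & f \notin P a).

(** [X] is nonempty and has finite Krull dimension [d] *)
Definition has_dim T (X : affine_scheme T) (d : nat) : Prop :=
  prime_chain X d /\ (forall e, prime_chain X e -> (e <= d)%N).

(** [f (sum_s x_(t,s) tau^s)_t] as a polynomial in [tau] *)
Definition generic_jet T (m : nat) (f : fpoly T) :
  {poly (fpoly (T * 'I_m.+1)%type)} :=
  ev (polyC \o @mpolyC #|{: T * 'I_m.+1}| k)
     (fun t => \poly_(s < m.+1) var (t, inord s)) f.

(** The [m]-th jet scheme. The coordinate [(t, s)] is the coefficient of
    [tau^s] in the coordinate [t]; see [jet_schemeP] for the functor it
    represents. *)
Definition jet_scheme (m : nat) T (X : affine_scheme T) :
  affine_scheme (T * 'I_m.+1)%type :=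
  [seq (generic_jet m f)`_s | f <- X, s <- iota 0 m.+1].

(** The product over [A^K] of [i] copies of [A^S], for the morphism
    [A^S -> A^K] with components [p]: the points are the [(y, x_1, .., x_i)]
    with [p x_j = y] for all [j] (so the empty product is [A^K]). *)
Definition fiber_power (i : nat) S K (p : K -> fpoly S) :
  affine_scheme (K + 'I_i * S)%type :=
  [seq ev (@mpolyC #|{: K + 'I_i * S}| k)
          (fun s => var (inr (j, s)) : fpoly (K + 'I_i * S)%type) (p y)
       - var (inl y)
     | j <- enum 'I_i, y <- enum K].

(** The Chevalley map from [gl_n] to the space of monic polynomials of degree
    [n], the latter with the non-leading coefficients as coordinates. *)
Definition chevalley (n : nat) (y : 'I_n) : fpoly ('I_n * 'I_n)%type :=
  (char_poly (\matrix_(a < n, b < n) var (a, b)))`_y.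

Definition gl_fiber_power (n i : nat) :
  affine_scheme ('I_n + 'I_i * ('I_n * 'I_n))%type :=
  fiber_power i (@chevalley n).

End AffineSchemes.

Arguments gl_fiber_power : clear implicits.

Section Points.
Variable k : comNzRingType.
Implicit Types S T K : finType.

Lemma ev_var T (B : comNzRingType) (phi : {rmorphism k -> B}) (v : T -> B) t :
  ev phi v (var k t) = v t.
Proof. by rewrite /ev /var mmapX mmap1U /= enum_rankK. Qed.

Lemma eq_ev T (B : comNzRingType) (phi phi' : {rmorphism k -> B})
  (v v' : T -> B) : phi =1 phi' -> v =1 v' -> ev phi v =1 ev phi' v'.
Proof.
move=> ei evv f; rewrite /ev /mmap; apply: eq_bigr => c _; rewrite ei.
by congr (_ * _); apply: mmap1_eq => t /=; rewrite evv.
Qed.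

Lemma ev_comp T (B C : comNzRingType) (phi : {rmorphism k -> B})
  (g : {rmorphism B -> C}) (v : T -> B) f :
  g (ev phi v f) = ev (g \o phi) (g \o v) f.
Proof.
rewrite /ev /mmap rmorph_sum; apply: eq_bigr => c _.
rewrite rmorphM; congr (_ * _); rewrite /mmap1 rmorph_prod.
by apply: eq_bigr => t _; rewrite rmorphXn.
Qed.

HB.instance Definition _ T (B : comNzRingType) (phi : {rmorphism k -> B})
  (v : T -> B) := GRing.RMorphism.copy (ev phi v) (mmap phi (v \o enum_val)).

Section Jets.
Variables (T : finType) (m : nat) (B : comNzRingType).
Variable phi : {rmorphism k -> B}.

(** The structure map of the [k]-algebra [B[tau]/(tau^(m+1))] *)
Definition jet_algebra_map : k -> {poly %/ ('X^(m.+1) : {poly B})} :=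
  in_qpoly 'X^(m.+1) \o polyC \o phi.
HB.instance Definition _ := GRing.RMorphism.copy jet_algebra_map
  (in_qpoly ('X^(m.+1) : {poly B}) \o polyC \o phi).

Definition jet_coords (w : T -> {poly %/ ('X^(m.+1) : {poly B})}) :
  T * 'I_m.+1 -> B := fun ts => (w ts.1 : {poly B})`_ts.2.

Lemma jet_coords_inj w w' : jet_coords w =1 jet_coords w' -> w =1 w'.
Proof.
move=> e t; apply/val_inj/polyP => s /=.
case: (ltnP s m.+1) => [ltsm|lems]; first exact: (e (t, Ordinal ltsm)).
have sz (x : {poly %/ ('X^(m.+1) : {poly B})}) : (size (x : {poly B}) <= s)%N.
  by apply: leq_trans lems; rewrite -ltnS (leq_trans (size_mk_monic x)) //
    mk_monic_Xn size_polyXn.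
by rewrite !nth_default.
Qed.

Lemma jet_coords_surj v : exists w, jet_coords w =1 v.
Proof.
exists (fun t => in_qpoly 'X^(m.+1) (\poly_(s < m.+1) v (t, inord s))).
move=> [t s]; rewrite /jet_coords in_qpoly_small /=; last first.
  by rewrite mk_monic_Xn size_polyXn ltnS size_poly.
by rewrite coef_poly ltn_ord inord_val.
Qed.

(** [jet_scheme m X] represents [B |-> X (B[tau]/(tau^(m+1)))]. *)
Lemma jet_schemeP (X : affine_scheme k T) w :
  is_point X jet_algebra_map w <-> is_point (jet_scheme m X) phi (jet_coords w).
Proof.
have in0 (p : {poly B}) :
    in_qpoly 'X^(m.+1) p = 0 <-> forall s, (s < m.+1)%N -> p`_s = 0.
  have vE : val (in_qpoly 'X^(m.+1) p) = take_poly m.+1 p.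
    by rewrite Pdiv.RingMonic.take_poly_rmodp /= mk_monic_Xn.
  split=> [e s lts|e].
    by move: (congr1 (fun q => (val q : {poly B})`_s) e);
      rewrite vE coef_take_poly lts /= coef0.
  apply/val_inj/polyP => s; rewrite vE coef_take_poly coef0.
  by case: ifP => // /e.
have szw t : (size (w t : {poly B}) <= m.+1)%N.
  by rewrite -ltnS (leq_trans (size_mk_monic _)) // mk_monic_Xn size_polyXn.
have key f s :
    ev phi (jet_coords w) (generic_jet m f)`_s
    = (ev (polyC \o phi) (fun t => w t : {poly B}) f)`_s.
  rewrite -[LHS](coef_map (ev phi (jet_coords w))); congr ((polyseq _)`_s).
  rewrite /generic_jet [LHS]ev_comp; apply: eq_ev => [c|t] /=.
    by rewrite map_polyC /= /ev mmapC.
  apply/polyP => r; rewrite coef_map coef_poly.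
  case: ltnP => [ltr|ler]; first by rewrite /= ev_var /jet_coords /= inordK.
  rewrite nth_default ?(leq_trans (szw t)) //.
  exact: (rmorph0 (ev phi (jet_coords w))).
have keyq f : ev jet_algebra_map w f
    = in_qpoly 'X^(m.+1) (ev (polyC \o phi) (fun t => w t : {poly B}) f).
  rewrite [RHS]ev_comp; apply: eq_ev => // t /=; apply/val_inj.
  exact/esym/in_qpoly_small/size_mk_monic.
split=> [wX _ /allpairsP[[f s] [fX + ->]]|wX f fX].
  rewrite mem_iota add0n /= key => lts; simpl in fX.
  by move: s lts; apply/in0; rewrite -keyq; apply: wX.
rewrite keyq; apply/in0 => s lts; rewrite -key; apply: wX.
by apply: allpairs_f => //; rewrite mem_iota.
Qed.

End Jets.

Lemma fiber_powerP (i : nat) S K (p : K -> fpoly k S) (B : comNzRingType)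
  (phi : {rmorphism k -> B}) (v : K + 'I_i * S -> B) :
  is_point (fiber_power i p) phi v <->
  forall j y, ev phi (fun s => v (inr (j, s))) (p y) = v (inl y).
Proof.
have key j y : ev phi v (ev (@mpolyC #|{: K + 'I_i * S}| k)
      (fun s => var k (inr (j, s)) : fpoly k (K + 'I_i * S)%type) (p y))
    = ev phi (fun s => v (inr (j, s))) (p y).
  rewrite ev_comp; apply: eq_ev => [c|s] /=; last by rewrite ev_var.
  by rewrite /ev mmapC.
split=> [vX j y|vX _ /allpairsP[[j y] /= [_ _ ->]]].
  apply/eqP; rewrite -subr_eq0 -key -(ev_var phi v (inl y)) -rmorphB.
  by apply/eqP/vX/allpairs_f; rewrite mem_enum.
by rewrite rmorphB /= key ev_var vX subrr.
Qed.

Lemma chevalleyP (n : nat) (B : comNzRingType) (phi : {rmorphism k -> B})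
  (v : 'I_n * 'I_n -> B) (y : 'I_n) :
  ev phi v (chevalley k y) = (char_poly (\matrix_(a, b) v (a, b)))`_y.
Proof.
rewrite -(coef_map (ev phi v)) map_char_poly; congr ((char_poly _)`_y).
by apply/matrixP => a b; rewrite !mxE /= ev_var.
Qed.

(** The points of [gl_fiber_power n i] are the [i]-tuples of matrices together
    with a monic polynomial of degree [n] which is the characteristic
    polynomial of each of them. *)
Lemma gl_fiber_powerP (n i : nat) (B : comNzRingType)
  (phi : {rmorphism k -> B}) (v : 'I_n + 'I_i * ('I_n * 'I_n) -> B) :
  is_point (gl_fiber_power k n i) phi v <->
  forall j, char_poly (\matrix_(a, b) v (inr (j, (a, b))))
            = 'X^n + \sum_(y < n) v (inl y) *: 'X^y.
Proof.
have coefR (r : nat) : ('X^n + \sum_(y < n) v (inl y) *: 'X^y : {poly B})`_r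
    = (r == n)%:R + \sum_(y < n) v (inl y) *+ (r == y).
  rewrite coefD coefXn coef_sum; congr (_ + _); apply: eq_bigr => y _.
  by rewrite coefZ coefXn mulr_natr.
have coefR_lt (y : 'I_n) :
    ('X^n + \sum_(y < n) v (inl y) *: 'X^y : {poly B})`_y = v (inl y).
  rewrite coefR (ltn_eqF (ltn_ord y)) add0r (bigD1 y) //= eqxx big1 ?addr0 //.
  by move=> z /negPf zy; rewrite eq_sym (inj_eq val_inj) zy.
rewrite fiber_powerP; split=> [e j|e j y]; last by rewrite chevalleyP e.
set M := (\matrix_(a, b) _).
have /monicP lM := char_poly_monic M; have sM := size_char_poly M.
apply/polyP => r; case: (ltngtP r n) => [ltr|gtr|->].
- by rewrite (coefR_lt (Ordinal ltr)) -(e j) chevalleyP.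
- rewrite nth_default ?sM // coefR gtn_eqF // add0r big1 // => y _.
  by rewrite gtn_eqF // (ltn_trans (ltn_ord y)).
- rewrite coefR eqxx big1 ?addr0 => [|y _]; last by rewrite gtn_eqF.
  by rewrite -[RHS]lM /lead_coef sM.
Qed.

End Points.

(* Main.v *)
(** A chain of primes of length [d] gives, over the residue field [K] of its
    smallest prime, [d] algebraically independent elements, so [d] is at most
    the number of elements generating the field of coordinates of a
    [K]-point. A [K]-point of the jet scheme is a tuple of matrices over
    [A = K[t]/(t^(m+1))] with a common characteristic polynomial, and it is
    enough to show that an [n x n] matrix over [A] is determined, rationally
    and given its characteristic polynomial, by [(m+1)(n^2-n)] elements of [K].

    This is a Hessenberg reduction over the chain ring [A]. If the part of the
    first column below the diagonal is [t^d] times a unimodular vector, it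
    depends on [(n-1)(m+1-d)] parameters only, and it can be conjugated to
    [t^d] times a basis vector; continuing with the lower right block one
    obtains valuations [d_1, .., d_(n-1)] and a saving of [sum_k (n-k) d_k].
    The characteristic polynomial is linear in the first row of the resulting
    Hessenberg matrix, and determines its [j]-th entry up to precision
    [m+1-(d_1+..+d_(j-1))]; the precision lost on the whole row is again
    [sum_k (n-k) d_k], which is exactly what has been saved.

    Conversely the last row of a generic matrix is a rational function of the
    other rows and of the characteristic polynomial, so the fiber power is
    rationally parametrised by [n + i(n^2-n)] of its coordinates, and
    specialising these one after the other gives a chain of primes. *)

From HB Require Import structures.
From Stdlib Require Import ClassicalEpsilon.
Require Import Defs.
From mathcomp Require Import all_boot all_order all_algebra.
From mathcomp Require Import ring.
From mathcomp Require Import ring_quotient generic_quotient fraction qpoly.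
From mathcomp Require Import fingroup perm mpoly.

Set Implicit Arguments.
Unset Strict Implicit.
Unset Printing Implicit Defensive.

Import GRing.Theory.
Local Open Scope ring_scope.

(** * Prime chains and algebraic independence *)

Section FractionField.
Variable A : comNzRingType.

(* [{fraction _}] needs a ring with an inverse operation, which a quotient
   ring does not have; it is chosen classically. *)
Definition with_inverses : Type := A.
HB.instance Definition _ := GRing.ComNzRing.on with_inverses.

Let unitA (x : with_inverses) : bool :=
  if excluded_middle_informative (exists y, y * x = 1) then true else false.
Let invA (x : with_inverses) : with_inverses :=
  if unitA x then epsilon (inhabits 0) (fun y => y * x = 1) else x.

Let unitAP x : unitA x <-> exists y, y * x = 1.
Proof. by rewrite /unitA; case: excluded_middle_informative. Qed.

Let mulVA : {in unitA, left_inverse 1 invA *%R}.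
Proof.
move=> x ux; rewrite /invA (_ : unitA x = true) //.
exact: (epsilon_spec (inhabits 0) _ ((unitAP x).1 ux)).
Qed.

Let unitAPl x y : y * x = 1 -> unitA x.
Proof. by move=> xy; apply/unitAP; exists y. Qed.

Let invA_out : {in [predC unitA], invA =1 id}.
Proof. by move=> x nux; rewrite /invA ifN. Qed.

HB.instance Definition _ :=
  GRing.ComNzRing_hasMulInverse.Build with_inverses mulVA unitAPl invA_out.

Hypothesis integralA : forall x y : A, x * y = 0 -> (x == 0) || (y == 0).
Let integralA' (x y : with_inverses) : x * y = 0 -> (x == 0) || (y == 0).
Proof. exact: integralA. Qed.

Definition domain_with_inverses : Type := with_inverses.
HB.instance Definition _ := GRing.ComUnitRing.on domain_with_inverses.
HB.instance Definition _ :=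
  GRing.ComUnitRing_isIntegral.Build domain_with_inverses integralA'.

Lemma fraction_field_exists :
  exists (K : fieldType) (iota : {rmorphism A -> K}),
    forall x, (iota x == 0) = (x == 0).
Proof.
exists {fraction domain_with_inverses}.
exists (@tofrac domain_with_inverses
          : {rmorphism domain_with_inverses -> {fraction domain_with_inverses}}).
by move=> x; apply: tofrac_eq0.
Qed.
End FractionField.

Lemma ev_id (k : comNzRingType) (T : finType) (f : fpoly k T) :
  ev (@mpolyC #|T| k) (fun t : T => var k t) f = f.
Proof.
rewrite /ev /mmap [RHS]mpolyE; apply: eq_bigr => c _; rewrite mul_mpolyC.
congr (_ *: _); rewrite -mmap1_id; apply: mmap1_eq => t.
by rewrite /= /var enum_valK.
Qed.

Section ResidueField.
Variables (k : comNzRingType) (T : finType) (P : {pred fpoly k T}).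
Hypotheses (idP : idealr_closed P) (prP : prime_idealr_closed P).

Let I : fpoly k T -> bool := fun f => f \in P.
Let idI : idealr_closed I. Proof. exact: idP. Qed.
Let prI : prime_idealr_closed I. Proof. exact: prP. Qed.
HB.instance Definition _ := isIdealr.Build _ I idI.
HB.instance Definition _ := isPrimeIdealrClosed.Build _ I prI.

(** [K] is the fraction field of the quotient by [P], and [w] collects the classes of the variables:
    the generic point of the locus defined by [P]. *)
Lemma residue_field_exists :
  exists (K : fieldType) (phi : {rmorphism k -> K}) (w : T -> K),
    forall f, (ev phi w f == 0) = (f \in P).
Proof.
pose J : prime_idealr (fpoly k T) := I.
pose Q := Quotient.quot J.
have [K [iota iota0]] : exists (K : fieldType) (iota : {rmorphism Q -> K}),
    forall x, (iota x == 0) = (x == 0).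
  by apply: fraction_field_exists => x y; apply: Quotient.rquot_IdomainAxiom.
pose pi : {rmorphism fpoly k T -> Q} := \pi_Q%qT.
exists K, (iota \o pi \o @mpolyC #|T| k), (iota \o pi \o @var k T) => f.
rewrite -[X in X == 0](ev_comp (@mpolyC #|T| k) (iota \o pi)) ev_id /= iota0.
rewrite -(rmorph0 pi) /pi.
by rewrite -Quotient.idealrBE subr0.
Qed.
End ResidueField.

(** The lexicographically lowest term of a relation survives: powers of [x a] cancel because [P a]
    is prime and omits [x a], while higher terms keep a factor [x a] and fall into the next
    prime. *)
Lemma prime_chain_independent (k : fieldType) (R : comNzRingType)
    (iota : {rmorphism k -> R}) (d L : nat) (P : 'I_d.+1 -> {pred R})
    (x : 'I_d -> R) (c : {ffun 'I_d -> 'I_L} -> k) :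
    (forall a, idealr_closed (P a) /\ prime_idealr_closed (P a)) ->
    (forall a b : 'I_d.+1, (a < b)%N -> {subset P a <= P b}) ->
    (forall a : 'I_d, x a \in P (inord a.+1)) ->
    (forall a : 'I_d, x a \notin P (inord a)) ->
    \sum_e iota (c e) * \prod_a x a ^+ e a \in P ord0 ->
  forall e, c e = 0.
Proof.
move=> idealP incP xin xnotin sum0 e1; apply/eqP/negPn/negP => ce1.
have addP a u v : u \in P a -> v \in P a -> u + v \in P a.
  by move=> uP vP; have [[_ _ h] _] := idealP a; rewrite -[u]mul1r h.
have mulP a u v : v \in P a -> u * v \in P a.
  by move=> vP; have [[P0 _ h] _] := idealP a; rewrite -[u * v]addr0 h.
have prP a u v n : u \notin P a -> u ^+ n * v \in P a -> v \in P a.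
  move=> uP; elim: n => [|n IHn]; first by rewrite mul1r.
  rewrite exprS -mulrA => uvP; apply: IHn; have [_ pr] := idealP a.
  by have := pr _ _ uvP; rewrite (negPf uP).
(* After [j] steps one is left with the terms of lexicographically lowest
   exponents in the first [j] variables, with these variables divided out. *)
have main j : (j <= d)%N -> exists S : {set {ffun 'I_d -> 'I_L}},
    [/\ S != set0, {in S, forall e, c e != 0},
        {in S &, forall (e f : {ffun 'I_d -> 'I_L}) (a : 'I_d),
          (a < j)%N -> e a = f a}
      & \sum_(e in S) iota (c e) * \prod_(a < d | (j <= a)%N) x a ^+ e a
          \in P (inord j)].
  elim: j => [|j IHj] ltjd.
    exists [set e | c e != 0]; split=> [|e|//|].
    - by apply/set0Pn; exists e1; rewrite inE.
    - by rewrite inE.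
    rewrite (_ : inord 0 = ord0); last by apply/val_inj; rewrite /= inordK.
    move: sum0; rewrite (bigID (fun e => c e == 0)) /= big1 ?add0r.
      rewrite (eq_bigl (mem [set e | c e != 0])) // => e.
      by rewrite /= inE.
    by move=> e /eqP->; rewrite rmorph0 mul0r.
  have [S [/set0Pn[e0 e0S] nzS agreeS sumS]] := IHj (ltnW ltjd).
  pose a0 := Ordinal ltjd.
  have [em emS minS] : exists2 em, em \in S
      & forall e, e \in S -> (em a0 <= e a0)%N.
    by case: (arg_minnP (fun e : {ffun 'I_d -> 'I_L} => e a0 : nat) e0S) => em;
      exists em.
  pose S' := [set e in S | e a0 == em a0].
  exists S'; split=> [|e|e f|].
  - by apply/set0Pn; exists em; rewrite inE emS eqxx.
  - by rewrite inE => /andP[/nzS].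
  - rewrite !inE => /andP[eS /eqP e0m] /andP[fS /eqP f0m] a.
    rewrite ltnS leq_eqVlt => /orP[/eqP eaj|]; last exact: agreeS.
    by rewrite (_ : a = a0) ?e0m ?f0m //; apply/val_inj.
  pose Q (e : {ffun 'I_d -> 'I_L}) :=
    iota (c e) * \prod_(a < d | (j < a)%N) x a ^+ e a.
  have prodE e : e \in S ->
      iota (c e) * \prod_(a < d | (j <= a)%N) x a ^+ e a
      = x a0 ^+ em a0 * (x a0 ^+ (e a0 - em a0) * Q e).
    move=> /minS lee; rewrite mulrA -exprD subnKC // (bigD1 a0) //= mulrCA.
    congr (_ * (_ * _)); apply: eq_bigl => a.
    by rewrite ltn_neqAle eq_sym andbC.
  move: sumS; rewrite (eq_bigr _ prodE) -mulr_sumr => /prP.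
  rewrite (_ : inord j = inord a0) // => /(_ (xnotin a0)).
  rewrite (bigID (fun e : {ffun 'I_d -> 'I_L} => e a0 == em a0)) /=.
  set s1 := \sum_(_ in S | _) _; set s2 := \sum_(_ in S | _) _ => sum12.
  have lt_inord : ((inord j : 'I_d.+1) < (inord j.+1 : 'I_d.+1))%N.
    by rewrite !inordK // ltnS // ltnW.
  have {}sum12 := incP _ _ lt_inord _ sum12.
  have s2P : s2 \in P (inord j.+1).
    apply: (big_ind (fun z => z \in P (inord j.+1))) => [||e /andP[eS ne]].
    - by have [[]] := idealP (inord j.+1).
    - exact: addP.
    have lt : (em a0 < e a0)%N by rewrite ltn_neqAle minS // eq_sym ne.
    rewrite -(subnSK lt) exprSr -mulrA [x a0 * _]mulrC mulrA.
    exact: mulP (xin a0).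
  have -> : \sum_(e in S') Q e = s1 + s2 - s2.
    rewrite addrK; apply: eq_big => [e|e]; rewrite inE //.
    by move=> /andP[_ /eqP->]; rewrite subnn mul1r.
  by apply: addP => //; rewrite -mulN1r; apply: mulP.
(* At [j = d] no variable is left, and a single nonzero constant would lie in a proper ideal. *)
have [S [/set0Pn[e0 e0S] nzS agreeS]] := main d (leqnn d).
have -> : S = [set e0].
  apply/setP => e; rewrite inE; apply/idP/eqP => [eS|-> //].
  by apply/ffunP => a; apply: agreeS.
rewrite big_set1 big1 ?mulr1; last by move=> a; rewrite leqNgt ltn_ord.
move=> /(mulP _ (iota (c e0)^-1)); rewrite -rmorphM mulVf ?nzS // rmorph1.
by have [[_ /negP n1 _] _] := idealP (inord d).
Qed.

Section Generation.
Variables (k K : fieldType) (phi : {rmorphism k -> K}).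

(** Subfields of [K] as predicates; closure under inverses has no exception at 0 because
    [0^-1 = 0]. *)
Definition field_closed (E : K -> Prop) : Prop :=
  [/\ E 1, forall x y, E x -> E y -> E (x - y),
      forall x y, E x -> E y -> E (x * y) & forall x, E x -> E x^-1].

Definition generated (D : nat) (s : 'I_D -> K) (x : K) : Prop :=
  exists f g : {mpoly k[D]}, mmap phi s g != 0 /\ x = mmap phi s f / mmap phi s g.

Lemma generated_field_closed D (s : 'I_D -> K) : field_closed (generated s).
Proof.
split=> [|_ _ [f [g [g0 ->]]] [f' [g' [g'0 ->]]]
  |_ _ [f [g [g0 ->]]] [f' [g' [g'0 ->]]]|_ [f [g [g0 ->]]]].
- by exists 1, 1; rewrite rmorph1 oner_eq0 divr1.
- exists (f * g' - f' * g), (g * g').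
  rewrite rmorphB !rmorphM /= mulf_neq0 //; split=> //.
  by rewrite -[- (mmap phi s f' / _)]mulNr addf_div // mulNr.
- by exists (f * f'), (g * g'); rewrite !rmorphM /= mulf_neq0 // mulf_div.
have [f0|f0] := eqVneq (mmap phi s f) 0.
  by exists 0, 1; rewrite f0 mul0r invr0 rmorph1 oner_eq0 rmorph0 mul0r.
by exists g, f; rewrite f0 invf_div.
Qed.

Lemma generated_base D (s : 'I_D -> K) c : generated s (phi c).
Proof. by exists c%:MP, 1; rewrite rmorph1 oner_eq0 divr1 /= mmapC. Qed.

Lemma generated_gen D (s : 'I_D -> K) a : generated s (s a).
Proof. by exists 'X_a, 1; rewrite rmorph1 oner_eq0 divr1 /= mmapX mmap1U. Qed.

Lemma msize_mul_le D (p q : {mpoly k[D]}) m n :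
  (msize p <= m.+1 -> msize q <= n.+1 -> msize (p * q) <= (m + n).+1)%N.
Proof.
have [->|p0] := eqVneq p 0; first by rewrite mul0r msize0.
have [->|q0] := eqVneq q 0; first by rewrite mulr0 msize0.
move=> lep leq; rewrite msizeM //; have := leq_add lep leq.
by rewrite addSn addnS; case: (_ + _)%N.
Qed.

Lemma msize_exp_le D (p : {mpoly k[D]}) m n :
  (msize p <= m.+1 -> msize (p ^+ n) <= (n * m).+1)%N.
Proof.
move=> lep; elim: n => [|n IHn]; first by rewrite expr0 msize1.
by rewrite exprS mulSn msize_mul_le.
Qed.

Lemma msize_prod_le D d (F : 'I_d -> {mpoly k[D]}) m :
  (forall a, msize (F a) <= m.+1)%N -> (msize (\prod_a F a) <= (d * m).+1)%N.
Proof.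
move=> leF; elim: d F leF => [|d IHd] F leF; first by rewrite big_ord0 msize1.
by rewrite big_ord_recl mulSn msize_mul_le // IHd.
Qed.

(** Polynomials of degree at most [B] have exponents at most [B] in each variable, hence at most
    [B.+1 ^ D] coefficients; a larger family is linearly dependent. *)
Lemma dependent_of_msize_le D B (I : finType) (H : I -> {mpoly k[D]}) :
    (forall e, msize (H e) <= B.+1)%N -> (B.+1 ^ D < #|I|)%N ->
  exists c : I -> k, (exists e, c e != 0) /\ \sum_e c e *: H e = 0.
Proof.
move=> leH ltI; pose J := {ffun 'I_D -> 'I_B.+1}.
pose A : 'M[k]_(#|I|, #|{: J}|) := \matrix_(e, j)
  (H (enum_val e))@_[multinom ((enum_val j : J) l : nat) | l < D].
have : kermx A != 0.
  rewrite kermx_eq0 /row_free neq_ltn (leq_ltn_trans (rank_leq_col A)) //.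
  by rewrite card_ffun !card_ord.
move=> /rowV0Pn[v /sub_kermxP vA /rV0Pn[e0 ve0]].
exists (fun e => v 0 (enum_rank e)); split.
  by exists (enum_val e0); rewrite enum_valK.
apply/mpolyP => m; rewrite mcoeff0 raddf_sum /=.
have [lem|ltm] := leqP (mdeg m) B; last first.
  rewrite big1 // => e _; rewrite mcoeffZ memN_msupp_eq0 ?mulr0 //.
  by apply: msize_mdeg_ge; apply: leq_trans (leH e) ltm.
have lem' (l : 'I_D) : (m l < B.+1)%N.
  by rewrite ltnS (leq_trans _ lem) // mdegE (bigD1 l) //= leq_addr.
pose j : J := [ffun l => Ordinal (lem' l)].
have := congr1 (fun M : 'rV_#|{: J}| => M 0 (enum_rank j)) vA.
rewrite !mxE => vAj; rewrite -[RHS]vAj.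
rewrite (reindex (@enum_val I I)) /=; last exact/onW_bij/enum_val_bij.
apply: eq_bigr => e _; rewrite mxE mcoeffZ enum_valK enum_rankK.
by congr (_ * _@__); apply/mnmP => l; rewrite mnmE ffunE.
Qed.

(** Dimension count: over a common denominator the [L ^ d] monomials in [X] become polynomials in
    [D] variables of degree [O(L)], a space of dimension [O(L ^ D)], and [D < d]. *)
Lemma dependent_of_generated d D (s : 'I_D -> K) (X : 'I_d -> K) :
    (forall a, generated s (X a)) -> (D < d)%N ->
  exists (L : nat) (c : {ffun 'I_d -> 'I_L} -> k),
    (exists e, c e != 0) /\ \sum_e phi (c e) * \prod_a X a ^+ e a = 0.
Proof.
move=> genX ltDd.
have [f genf] := fin_all_exists genX; have [g fgP] := fin_all_exists genf.
pose G := \prod_a g a.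
pose F a := f a * \prod_(b | b != a) g b.
have G0 : mmap phi s G != 0.
  by rewrite rmorph_prod /=; apply/prodf_neq0 => a _; case: (fgP a).
have FE a : mmap phi s (F a) = X a * mmap phi s G.
  have [ga0 ->] := fgP a; rewrite /G (bigD1 a) //= !rmorphM /= mulrA.
  by rewrite divfK.
pose b := (\sum_a msize (F a) + msize G)%N.
have leF a : (msize (F a) <= b.+1)%N.
  by rewrite ltnW // ltnS /b (bigD1 a) //= -addnA leq_addr.
have leG : (msize G <= b.+1)%N by rewrite ltnW // ltnS leq_addl.
(* This choice gives [(d * (L * b)).+1 ^ D <= L ^ D * (d * b).+1 ^ D < L ^ D.+1 <= L ^ d]. *)
pose L := ((d * b).+1 ^ D).+1; exists L.
pose H (e : {ffun 'I_d -> 'I_L}) := \prod_a (F a ^+ e a * G ^+ (L - e a)).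
have leH e : (msize (H e) <= (d * (L * b)).+1)%N.
  apply: msize_prod_le => a; 
  have -> : (L * b = e a * b + (L - e a) * b)%N.
    by rewrite -mulnDl subnKC // ltnW.
  by apply: msize_mul_le; apply: msize_exp_le.
have ltL : ((d * (L * b)).+1 ^ D < #|{: {ffun 'I_d -> 'I_L}}|)%N.
  rewrite card_ffun !card_ord; apply: (@leq_ltn_trans ((L * (d * b).+1) ^ D)).
    by case: (posnP D) => [->|D0] //; rewrite leq_exp2r // mulnCA mulnS addnC
      -addn1 leq_add2l.
  apply: (@leq_trans (L ^ D.+1)); last by rewrite leq_pexp2l.
  by rewrite expnMn expnS mulnC ltn_pmul2r // expn_gt0.
have [c [c0 cH]] := dependent_of_msize_le leH ltL.
exists c; split=> //.
have := congr1 (mmap phi s) cH; rewrite rmorph0 rmorph_sum /=.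
have HE e : mmap phi s (c e *: H e)
    = (phi (c e) * \prod_a X a ^+ e a) * mmap phi s G ^+ L ^+ d.
  rewrite mmapZ -mulrA; congr (_ * _); rewrite rmorph_prod /=.
  have -> : mmap phi s G ^+ L ^+ d = \prod_(a < d) mmap phi s G ^+ L.
    by rewrite prodr_const card_ord.
  rewrite -big_split; apply: eq_bigr => a _ /=.
  rewrite rmorphM !rmorphXn /= FE exprMn -mulrA -exprD subnKC //.
  exact/ltnW/ltn_ord.
rewrite (eq_bigr _ (fun e _ => HE e)) -mulr_suml => /eqP.
by rewrite mulf_eq0 (negPf (expf_neq0 _ (expf_neq0 _ G0))) orbF => /eqP.
Qed.

End Generation.

(** At the generic point of the smallest prime, elements separating consecutive primes take
    algebraically independent values in a field with at most [D] generators. Quantifying over all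
    subfields [E] expresses generation without exhibiting rational functions. *)
Lemma prime_chain_le (k : fieldType) (T : finType) (X : affine_scheme k T)
    (D d : nat) :
    (forall (K : fieldType) (phi : {rmorphism k -> K}) (w : T -> K),
       is_point X phi w ->
       exists s : seq K, (size s <= D)%N /\
         forall E, field_closed E -> (forall c, E (phi c)) ->
           (forall x, x \in s -> E x) -> forall t, E (w t)) ->
  prime_chain X d -> (d <= D)%N.
Proof.
move=> genX [P [primeP chainP]]; rewrite leqNgt; apply/negP => ltDd.
have [id0 pr0 subX] := primeP ord0.
have [K [phi [w kerw]]] := residue_field_exists id0 pr0.
have wX : is_point X phi w by move=> f /subX fP; apply/eqP; rewrite kerw.
have [s [les Es]] := genX K phi w wX.
have stepP (a : 'I_d) :
    exists f, (f \in P (inord a.+1)) && (f \notin P (inord a)).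
  have [|_ [f f1 f0]] := chainP (inord a) (inord a.+1).
    by rewrite !inordK // ltnS // ltnW.
  by exists f; rewrite f1.
pose x a := xchoose (stepP a).
have xP a : (x a \in P (inord a.+1)) && (x a \notin P (inord a)).
  exact: xchooseP (stepP a).
pose s' (a : 'I_(size s)) := s`_a.
have genw t : generated phi s' (w t).
  apply: Es => [|c|y /(nthP 0)[a lta <-]]; first exact: generated_field_closed.
    exact: generated_base.
  exact: (generated_gen phi s' (Ordinal lta)).
have [E1 Esub Emul _] := generated_field_closed phi s'.
have E0 : generated phi s' 0 by rewrite -(subrr 1); apply: Esub.
have Eadd u v :
    generated phi s' u -> generated phi s' v -> generated phi s' (u + v).
  by move=> Eu Ev; rewrite -[v]opprK -[- v]sub0r; apply/Esub/Esub.
have gen_ev f : generated phi s' (ev phi w f).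
  rewrite /ev /mmap; apply: (big_ind _ E0 Eadd) => m _.
  apply: (Emul); first exact: generated_base.
  rewrite /mmap1; apply: (big_ind _ E1 Emul) => i _.
  elim: (m i) => [|n IHn]; rewrite ?expr0 // exprS.
  by apply: Emul => //; apply: genw.
have [L [c [[e /eqP ce] sum0]]] :=
  dependent_of_generated (fun a => gen_ev (x a)) (leq_ltn_trans les ltDd).
apply: ce; move: e.
apply: (@prime_chain_independent _ _ (@mpolyC #|T| k) d L P x)
  => [a|a b /chainP[]//|a|a|].
- by have [] := primeP a.
- by have /andP[] := xP a.
- by have /andP[] := xP a.
rewrite -kerw rmorph_sum /=; apply/eqP; rewrite -[RHS]sum0; apply: eq_bigr => e _.
rewrite rmorphM /= {1}/ev mmapC rmorph_prod /=; congr (_ * _).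
by apply: eq_bigr => a _; rewrite rmorphXn.
Qed.

(** * Matrices over truncated power series *)

(** An interface to [K[t]/(t^(m+1))] that reaches jets only through their coefficients; those beyond
    [m] are 0. *)
Record truncated_algebra (K : fieldType) (m : nat) := TruncatedAlgebra {
  talg :> comUnitRingType;
  tcoef : talg -> nat -> K;
  tcoef1 : forall s, tcoef 1 s = (s == 0%N)%:R;
  tcoefB : forall a b s, tcoef (a - b) s = tcoef a s - tcoef b s;
  tcoefM : forall a b s, (s < m.+1)%N ->
    tcoef (a * b) s = \sum_(j < s.+1) tcoef a j * tcoef b (s - j)%N;
  tcoef_ge : forall a s, (m < s)%N -> tcoef a s = 0;
  tcoef_inj : forall a b,
    (forall s, (s < m.+1)%N -> tcoef a s = tcoef b s) -> a = b;
  tseries : (nat -> K) -> talg;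
  tcoef_series : forall f s, (s < m.+1)%N -> tcoef (tseries f) s = f s;
  tcoef_unit : forall a, tcoef a 0 != 0 -> a \is a GRing.unit
}.

Section QuotientTruncation.
Variables (K : fieldType) (m : nat).
Local Notation A := {poly %/ ('X^(m.+1) : {poly K})}.
Implicit Types a b : A.

Let in_qpolyE (p : {poly K}) s :
  (in_qpoly 'X^(m.+1) p : {poly K})`_s = if (s < m.+1)%N then p`_s else 0.
Proof.
rewrite (_ : polyseq _ = take_poly m.+1 p) ?coef_take_poly //.
by rewrite Pdiv.RingMonic.take_poly_rmodp /= mk_monic_Xn.
Qed.

Let coef1A s : ((1 : A) : {poly K})`_s = (s == 0%N)%:R.
Proof. by rewrite /= coefC; case: s. Qed.

Let coefBA a b s : (a - b : {poly K})`_s = (a : {poly K})`_s - (b : {poly K})`_s.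
Proof. by rewrite /= coefB. Qed.

Let coefMA a b s : (s < m.+1)%N ->
  (a * b : {poly K})`_s
  = \sum_(j < s.+1) (a : {poly K})`_j * (b : {poly K})`_(s - j).
Proof. by move=> lts; rewrite [a * b]/(in_qpoly _ _) in_qpolyE lts coefM. Qed.

Let coef_geA a s : (m < s)%N -> (a : {poly K})`_s = 0.
Proof.
move=> lts; rewrite nth_default // (leq_trans _ lts) // -ltnS.
by rewrite (leq_trans (size_mk_monic a)) // mk_monic_Xn size_polyXn.
Qed.

Let coef_injA a b :
  (forall s, (s < m.+1)%N -> (a : {poly K})`_s = (b : {poly K})`_s) -> a = b.
Proof.
move=> eqab; apply/val_inj/polyP => s /=; have [/eqab //|les] := ltnP s m.+1.
by rewrite !coef_geA.
Qed.

Let seriesA (f : nat -> K) : A := in_qpoly 'X^(m.+1) (\poly_(s < m.+1) f s).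

Let coef_seriesA f s : (s < m.+1)%N -> (seriesA f : {poly K})`_s = f s.
Proof. by move=> lts; rewrite in_qpolyE lts coef_poly lts. Qed.

Let coef_unitA a : (a : {poly K})`_0 != 0 -> a \is a GRing.unit.
Proof.
move=> a0; suff : coprimep (mk_monic 'X^(m.+1)) (a : {poly K}) by [].
move: (a : {poly K}) a0 => p p0; rewrite mk_monic_Xn coprimep_expl //.
by rewrite coprimep_sym coprimepX /root horner_coef0.
Qed.

Definition qpoly_truncated : truncated_algebra K m :=
  TruncatedAlgebra coef1A coefBA coefMA coef_geA coef_injA coef_seriesA
    coef_unitA.

End QuotientTruncation.

Section TruncatedSeries.
Variables (K : fieldType) (m : nat) (A : truncated_algebra K m).
Local Notation co := (@tcoef K m A).
Implicit Types a b : A.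

Lemma tcoef0 s : co 0 s = 0.
Proof. by rewrite -(subrr 1) tcoefB subrr. Qed.

Definition tau (d : nat) : A := tseries A (fun s => (s == d)%:R).

Lemma tcoef_tauM d a s : (s < m.+1)%N ->
  co (tau d * a) s = if (s < d)%N then 0 else co a (s - d).
Proof.
move=> lts; rewrite tcoefM //.
rewrite (eq_bigr (fun j : 'I_s.+1 => (j == d :> nat)%:R * co a (s - j))).
  have [ltsd|leds] := ltnP s d.
    rewrite big1 // => j _; rewrite ltn_eqF ?mul0r // (leq_ltn_trans _ ltsd) //.
    by rewrite -ltnS.
  rewrite (bigD1 (Ordinal (leds : d < s.+1)%N)) //= eqxx mul1r big1 ?addr0 // => j.
  by rewrite -val_eqE /= => /negPf->; rewrite mul0r.
by move=> j _; rewrite tcoef_series // (leq_ltn_trans _ lts) // -ltnS.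
Qed.

(** [d] is the least order of an entry. Since [t^d] kills everything from order [m.+1 - d] on, [w]
    can be cut off there, and then depends on [m.+1 - d] coefficients per entry. *)
Lemma truncated_valuation p (v : 'cV[A]_p) :
  v = 0 \/ exists (d : nat) (w : 'cV[A]_p) (i : 'I_p),
    [/\ (d < m.+1)%N, v = tau d *: w, w i 0 \is a GRing.unit
      & forall j s, (m.+1 - d <= s)%N -> co (w j 0) s = 0].
Proof.
pose nz s := [exists i, co (v i 0) s != 0].
have [/existsP/= [s0 nz0]|/existsPn/= z] :=
  boolP [exists s : 'I_m.+1, nz s]; last first.
  left; apply/matrixP => i j; rewrite ord1 mxE; apply: tcoef_inj => s lts.
  have /existsPn/(_ i) /negPn/eqP -> := z (Ordinal lts).
  by rewrite tcoef0.
right; have exnz : exists s, nz s by exists s0.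
have [d /existsP[i vid] mind] := ex_minnP exnz.
have ltd : (d < m.+1)%N := leq_ltn_trans (mind _ nz0) (ltn_ord s0).
pose w j : A :=
  tseries A (fun s => if (s < m.+1 - d)%N then co (v j 0) (s + d) else 0).
exists d, (\col_j w j), i; split=> // [||j s les].
- apply/matrixP => j r; rewrite ord1 !mxE; apply: tcoef_inj => s lts.
  rewrite tcoef_tauM //; have [ltsd|leds] := ltnP s d; last first.
    by rewrite tcoef_series ?ltn_sub2r ?subnK // (leq_ltn_trans (leq_subr _ _)).
  apply/eqP/negPn/negP => nzs; have /mind : nz s by apply/existsP; exists j.
  by rewrite leqNgt ltsd.
- by apply: tcoef_unit; rewrite mxE tcoef_series // subn_gt0 ltd.
rewrite mxE; have [lts|] := ltnP s m.+1; last exact: tcoef_ge.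
by rewrite tcoef_series // ltnNge les.
Qed.

Variable E : K -> Prop.
Hypothesis closedE : field_closed E.

Let E1 : E 1. Proof. by case: closedE. Qed.
Let EB x y : E x -> E y -> E (x - y).
Proof. by case: closedE => _ h _ _; apply: h. Qed.
Let EM x y : E x -> E y -> E (x * y).
Proof. by case: closedE => _ _ h _; apply: h. Qed.
Let EV x : E x -> E x^-1. Proof. by case: closedE => _ _ _; apply. Qed.
Let E0 : E 0. Proof. by rewrite -(subrr 1); apply: EB. Qed.
Let ED x y : E x -> E y -> E (x + y).
Proof. by move=> Ex Ey; rewrite -[y]opprK -[- y]sub0r; apply/EB/EB. Qed.

(* The jet [a] is defined over the subfield [E] up to precision [t^r]. *)
Definition known (r : nat) a := forall s, (s < r)%N -> E (co a s).

Lemma knownW r r' a : (r' <= r)%N -> known r a -> known r' a.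
Proof. by move=> ler ka s lts; apply: ka; apply: leq_trans ler. Qed.

Lemma known0 r : known r 0.
Proof. by move=> s _; rewrite tcoef0. Qed.

Lemma known1 r : known r 1.
Proof. by move=> s _; rewrite tcoef1; case: (s == _). Qed.

Lemma knownB r a b : known r a -> known r b -> known r (a - b).
Proof. by move=> ka kb s lts; rewrite tcoefB; apply: EB; [apply: ka|apply: kb]. Qed.

Lemma knownN r a : known r a -> known r (- a).
Proof. by move=> ka; rewrite -sub0r; apply: knownB => //; apply: known0. Qed.

Lemma knownD r a b : known r a -> known r b -> known r (a + b).
Proof. by move=> ka kb; rewrite -[b]opprK; apply/knownB/knownN. Qed.

Lemma knownM r a b : known r a -> known r b -> known r (a * b).
Proof.
move=> ka kb s lts; have [ltsm|lesm] := ltnP s m.+1; last by rewrite tcoef_ge.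
rewrite tcoefM //; apply: (big_ind _ E0 ED) => j _.
apply: EM; first by apply: ka; apply: leq_trans lts; rewrite ltnS -ltnS.
by apply: kb; apply: leq_ltn_trans lts; apply: leq_subr.
Qed.

Lemma known_sum r (I : Type) (s : seq I) (Q : pred I) (F : I -> A) :
  (forall i, Q i -> known r (F i)) -> known r (\sum_(i <- s | Q i) F i).
Proof. exact: (big_ind _ (known0 (r := r)) (@knownD r)). Qed.

(** Solving [a * b = 1] coefficient by coefficient divides only by the constant term of [a]. *)
Lemma knownV r a : a \is a GRing.unit -> known r a -> known r a^-1.
Proof.
move=> ua ka; set b := a^-1.
have ab : a * b = 1 by rewrite divrr.
elim/ltn_ind => s IHs lts; have [ltsm|lesm] := ltnP s m.+1; last first.
  by rewrite tcoef_ge.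
have a0 : co a 0 != 0.
  apply/eqP => a0; have := congr1 (fun z : A => co z 0) ab.
  rewrite tcoefM // big_ord1 a0 mul0r tcoef1 => /esym/eqP.
  by rewrite oner_eq0.
have := congr1 (fun z : A => co z s) ab.
rewrite tcoefM // big_ord_recl subn0 tcoef1 => eqs.
have -> : co b s = (co a 0)^-1 * ((s == 0)%:R
    - \sum_(j < s) co a (lift ord0 j) * co b (s - lift ord0 j)%N).
  by rewrite -eqs addrK mulKf.
apply: EM; first by apply/EV/ka; apply: leq_ltn_trans lts.
apply: EB; first by case: (s == _).
apply: (big_ind _ E0 ED) => j _; rewrite lift0.
apply: EM; first by apply: ka; apply: leq_ltn_trans lts.
have ltj : (s - j.+1 < s)%N by rewrite ltn_subrL (leq_ltn_trans _ (ltn_ord j)).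
by apply: IHs; rewrite // (ltn_trans ltj).
Qed.

(** Multiplication by [t^d] shifts coefficients, so undoing it costs [d] digits of precision. *)
Lemma known_tauM r d a : (r <= m.+1)%N -> known r (tau d * a) -> known (r - d) a.
Proof.
move=> ler ka s; rewrite ltn_subRL addnC => lts.
have := ka _ lts; rewrite tcoef_tauM; last exact: leq_trans lts ler.
by rewrite addnK ltnNge leq_addl.
Qed.

Lemma known_tau r d : known r (tau d).
Proof.
move=> s _; have [lts|les] := ltnP s m.+1; last by rewrite tcoef_ge.
by rewrite tcoef_series //; case: (s == d).
Qed.

Definition known_mx (r p q : nat) (M : 'M[A]_(p, q)) := forall i j, known r (M i j).

Lemma known_mulmx r p q n (M : 'M[A]_(p, q)) (M' : 'M[A]_(q, n)) :
  known_mx r M -> known_mx r M' -> known_mx r (M *m M').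
Proof. by move=> kM kM' i j; rewrite mxE; apply: known_sum => l _; apply: knownM. Qed.

Lemma known_mxB r p q (M M' : 'M[A]_(p, q)) :
  known_mx r M -> known_mx r M' -> known_mx r (M - M').
Proof. by move=> kM kM' i j; rewrite !mxE; apply: knownB. Qed.

Lemma known_mx0 r p q : known_mx r (0 : 'M[A]_(p, q)).
Proof. by move=> i j; rewrite mxE; apply: known0. Qed.

Lemma known_mx1 r p : known_mx r (1%:M : 'M[A]_p).
Proof. by move=> i j; rewrite mxE; case: (i == j); [apply: known1|apply: known0]. Qed.

Lemma known_block r p1 p2 q1 q2 (a : 'M[A]_(p1, q1)) (b : 'M[A]_(p1, q2))
    (c : 'M[A]_(p2, q1)) (d : 'M[A]_(p2, q2)) :
    known_mx r a -> known_mx r b -> known_mx r c -> known_mx r d ->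
  known_mx r (block_mx a b c d).
Proof.
move=> ka kb kc kd i j; rewrite /block_mx mxE.
by case: splitP => i' _; rewrite mxE; case: splitP => j' _.
Qed.

(* Linear combinations, with known coefficients, of vectors that satisfy
   the hypothesis of the lemma satisfy it again. *)
Lemma known_krylov_block r p (a : 'M[A]_1) (b : 'rV[A]_p) (c : 'cV[A]_p)
    (Y : 'M[A]_p) (x : 'M[A]_1) (y : 'rV[A]_p) :
    let Y' : 'M[A]_(1 + p) := block_mx a b c Y in
    known_mx r Y' ->
    (forall l, known_mx r (row_mx x y *m Y' ^+ l *m col_mx 1%:M 0)) ->
  known_mx r x /\ forall l, known_mx r (y *m Y ^+ l *m c).
Proof.
move=> Y' kY'.
pose H (z : 'cV[A]_(1 + p)) := forall l, known_mx r (row_mx x y *m Y' ^+ l *m z).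
rewrite -/(H (col_mx 1%:M 0)); set e := col_mx _ _ => He.
have sub i j : exists i' j', Y i j = Y' i' j'.
  by exists (rshift 1 i), (rshift 1 j); rewrite block_mxEdr.
have kY : known_mx r Y by move=> i j; have [i' [j' ->]] := sub i j.
have ka : known_mx r a by move=> i j; rewrite -(block_mxEul a b c Y).
have kb : known_mx r b by move=> i j; rewrite -(block_mxEur a b c Y).
have kc : known_mx r c by move=> i j; rewrite -(block_mxEdl a b c Y).
have step z (s : 'M[A]_1) : H z -> known_mx r s -> H (Y' *m z - e *m s).
  move=> Hz ks l; rewrite mulmxBr; apply: known_mxB.
    have := Hz l.+1; rewrite (exprSr Y') -mulmxE !mulmxA; exact.
  by rewrite mulmxA; apply: known_mulmx.
(* [Y'] maps [(0, z)] to [(b z, Y z)], and a multiple of [e] removes the first entry. Starting from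
   [Y' e - e a = (0, c)] one reaches every [(0, Y ^+ l c)]. *)
have main l : H (col_mx 0 (Y ^+ l *m c)) /\ known_mx r (Y ^+ l *m c).
  elim: l => [|l [IH kz]].
    rewrite expr0 mul1mx; split=> //.
    have := step _ a He ka; rewrite /e mul_block_col mul_col_mx.
    rewrite !mul1mx !mulmx1 !mulmx0 !mul0mx !addr0.
    by rewrite opp_col_mx add_col_mx subrr subr0.
  rewrite (exprS Y) -mulmxE -mulmxA; split; last exact: known_mulmx.
  have := step _ (b *m (Y ^+ l *m c)) IH (known_mulmx kb kz).
  rewrite /e mul_block_col mul_col_mx !mul1mx !mulmx0 !mul0mx !add0r.
  by rewrite opp_col_mx add_col_mx subrr subr0.
split=> [|l].
  have := He 0%N; rewrite expr0 mulmx1 mul_row_col mulmx1 mulmx0 addr0; exact.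
have [/(_ 0%N)] := main l.
by rewrite expr0 mulmx1 mul_row_col mulmx0 add0r mulmxA.
Qed.

End TruncatedSeries.

(** * Bordered determinants and the adjugate of the characteristic matrix *)

Lemma det_bordered (R : comNzRingType) p (a : 'M[R]_1) (r : 'rV[R]_p)
    (v : 'cV[R]_p) (Y : 'M[R]_p) : GRing.lreg (\det Y) ->
  \det (block_mx a r v Y) = a 0 0 * \det Y - (r *m \adj Y *m v) 0 0.
Proof.
move=> regY; apply: regY; rewrite mulrC.
(* The second factor has determinant [\det Y] and clears the lower left block, since [Y *m \adj Y]
   is scalar. *)
have <- : \det (block_mx a r v Y *m block_mx (\det Y)%:M 0 (- (\adj Y *m v)) 1%:M)
    = \det (block_mx a r v Y) * \det Y.
  by rewrite det_mulmx det_lblock det1 mulr1 det_scalar1.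
rewrite mulmx_block !mulmx0 !mulmx1 !add0r !mulmxN !mulmxA mul_mx_adj.
rewrite !mul_mx_scalar mul_scalar_mx subrr det_ublock mulrC; congr (_ * _).
by rewrite [_ - _]mx11_scalar det_scalar1 !mxE [\det Y * _]mulrC.
Qed.

Section Adjugate.
Variables (R : comNzRingType) (p : nat) (Y : 'M[R]_p).

Definition adj_coef (j : nat) : 'M[R]_p := map_mx (coefp j) (\adj (char_poly_mx Y)).

(** This is the coefficient of [X^j] in [(X - Y) \adj (X - Y) = char_poly Y]. *)
Lemma adj_coef_rec j :
  Y *m adj_coef j = (if j is i.+1 then adj_coef i else 0) - ((char_poly Y)`_j)%:M.
Proof.
have := mul_mx_adj (char_poly_mx Y); rewrite -/(char_poly Y) mulmxBl mul_scalar_mx.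
move=> /(congr1 (map_mx (coefp j))) adjE; apply/matrixP => a b.
have := congr1 (fun M : 'M[R]_p => M a b) adjE; rewrite !mxE /= coefB.
rewrite coefMn => <-.
have -> : ('X * cofactor (char_poly_mx Y) b a)`_j
  = (if j is i.+1 then adj_coef i else 0) a b.
  by rewrite coefXM; case: j {adjE} => [|j]; rewrite !mxE.
rewrite subKr coef_sum; apply: eq_bigr => c _.
by rewrite [map_mx polyC Y a c]mxE coefCM [adj_coef j c b]mxE.
Qed.

(** Descending induction: all entries vanish in large degree, and for [p <= i] the recursion reads
    [adj_coef i = Y *m adj_coef i.+1]. *)
Lemma adj_coef_ge j : (p <= j)%N -> adj_coef j = 0.
Proof.
have sizeY := size_char_poly Y.
have stepdown i : (p <= i)%N -> adj_coef i.+1 = 0 -> adj_coef i = 0.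
  move=> lei z; have := adj_coef_rec i.+1; rewrite z mulmx0 nth_default ?sizeY //.
  by rewrite raddf0 subr0.
pose M := \max_(x : 'I_p * 'I_p) size (\adj (char_poly_mx Y) x.1 x.2).
have big i : (M <= i)%N -> adj_coef i = 0.
  move=> leM; apply/matrixP => a b; rewrite [LHS]mxE [RHS]mxE /= nth_default //.
  exact: leq_trans (leq_bigmax (a, b)) leM.
suff gen n i : (p <= i)%N -> (M <= i + n)%N -> adj_coef i = 0.
  by move=> /(gen (M - j)%N); rewrite -leq_subLR; apply.
elim: n i => [|n IHn] i lei; first by rewrite addn0; apply: big.
by rewrite addnS -addSn => /(IHn i.+1 (leqW lei)); apply: stepdown.
Qed.

Lemma adj_coef_last : (0 < p)%N -> adj_coef p.-1 = 1%:M.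
Proof.
move=> p0; have /= := adj_coef_rec p.-1.+1.
rewrite prednK // adj_coef_ge // mulmx0.
have -> : (char_poly Y)`_p = 1.
  by have /monicP := char_poly_monic Y; rewrite /lead_coef size_char_poly.
by move=> /esym/eqP; rewrite subr_eq0 => /eqP.
Qed.

End Adjugate.

Lemma char_poly_bordered (R : comNzRingType) p (a : 'M[R]_1) (r : 'rV[R]_p)
    (v : 'cV[R]_p) (Y : 'M[R]_p) (l : nat) :
  (char_poly (block_mx a r v Y))`_l
  = (('X - (a 0 0)%:P) * char_poly Y)`_l - (r *m adj_coef Y l *m v) 0 0.
Proof.
have -> : char_poly (block_mx a r v Y) = \det (block_mx ('X - (a 0 0)%:P)%:M
    (- map_mx polyC r) (- map_mx polyC v) (char_poly_mx Y)).
  congr (\det _); rewrite /char_poly_mx map_block_mx scalar_mx_block.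
  rewrite opp_block_mx add_block_mx !sub0r; congr block_mx.
  by rewrite [map_mx _ a]mx11_scalar mxE raddfB.
rewrite det_bordered; last exact/monic_lreg/char_poly_monic.
rewrite mxE eqxx mulr1n coefB mulmxN mulNmx mulNmx opprK; congr (_ - _).
rewrite !mxE coef_sum; apply: eq_bigr => b _; rewrite !mxE coefMC.
by congr (_ * _); rewrite coef_sum; apply: eq_bigr => c _; rewrite !mxE coefCM.
Qed.

(** * Hessenberg reduction and parameter count for one matrix *)

Section MatrixParameters.
Variables (K : fieldType) (m : nat) (A : truncated_algebra K m).
Local Notation co := (@tcoef K m A).

Definition mx_coefs (p q : nat) (M : 'M[A]_(p, q)) (lo len : nat) : seq K :=
  [seq co (M x.1 x.2) s | x <- enum {: 'I_p * 'I_q}, s <- iota lo len].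

Lemma size_mx_coefs p q (M : 'M[A]_(p, q)) lo len :
  size (mx_coefs M lo len) = (p * q * len)%N.
Proof. by rewrite size_allpairs size_iota -cardE card_prod !card_ord. Qed.

Lemma mx_coefsP p q (M : 'M[A]_(p, q)) lo len (E : K -> Prop) :
    (forall x, x \in mx_coefs M lo len -> E x) ->
  forall i j s, (lo <= s < lo + len)%N -> E (co (M i j) s).
Proof.
move=> ME i j s les; apply: ME.
by apply/allpairsP; exists ((i, j), s); rewrite /= mem_enum mem_iota.
Qed.

Lemma forall_cat (s1 s2 : seq K) (E : K -> Prop) :
    (forall x, x \in s1 ++ s2 -> E x) ->
  (forall x, x \in s1 -> E x) /\ (forall x, x \in s2 -> E x).
Proof. by move=> sE; split=> x xs; apply: sE; rewrite mem_cat xs ?orbT. Qed.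

(** A transposition moves the unit entry of [w] to the top, and a lower triangular matrix with the
    permuted [w] as first column completes it to a basis. [G] and [H] are built from [w] alone, so
    they add no parameters. *)
Lemma pivot_basis p (w : 'cV[A]_(1 + p)) i : w i 0 \is a GRing.unit ->
  exists G H : 'M[A]_(1 + p),
    [/\ H *m G = 1%:M, G *m H = 1%:M, G *m col_mx 1%:M 0 = w
      & forall E, field_closed E -> known_mx E m.+1 w ->
          known_mx E m.+1 G /\ known_mx E m.+1 H].
Proof.
move=> wu; pose S : 'M[A]_(1 + p) := tperm_mx (lshift p 0) i.
have SS : S *m S = 1%:M by rewrite -perm_mxM tperm2 perm_mx1.
pose w' : 'cV[A]_(1 + p) := S *m w.
pose u := w i 0.
have w'u : usubmx w' = u%:M.
  rewrite [LHS]mx11_scalar mxE /w' /S /tperm_mx -row_permE mxE /u.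
  by rewrite tpermL.
pose L : 'M[A]_(1 + p) := block_mx u%:M 0 (dsubmx w') 1%:M.
pose L' : 'M[A]_(1 + p) := block_mx u^-1%:M 0 (- (u^-1 *: dsubmx w')) 1%:M.
have L'L : L' *m L = 1%:M.
  rewrite mulmx_block ?(mulmx0, mul0mx, mul1mx, mulmx1, addr0, add0r).
  rewrite -scalar_mxM mulVr // mul_mx_scalar scalerN scalerA divrr //.
  by rewrite scale1r addNr -scalar_mx_block.
have LL' : L *m L' = 1%:M by apply: mulmx1C.
exists (S *m L), (L' *m S).
have HG : (L' *m S) *m (S *m L) = 1%:M.
  by rewrite mulmxA -(mulmxA L') SS mulmx1.
split=> //; first exact: mulmx1C.
  rewrite -mulmxA mul_block_col !mulmx1 !mulmx0 !addr0 -w'u vsubmxK.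
  by rewrite mulmxA SS mul1mx.
move=> E clE kw.
have kS : known_mx E m.+1 S.
  move=> a b; rewrite /S /tperm_mx !mxE.
  by case: (_ == b); [apply: known1|apply: known0].
have kw' : known_mx E m.+1 (dsubmx w').
  by move=> a b; rewrite mxE; apply: known_mulmx.
have ku (c : A) : known E m.+1 c -> known_mx E m.+1 (c%:M : 'M_1).
  by move=> kc a b; rewrite !ord1 mxE eqxx.
have ku' : known E m.+1 u^-1 by apply: knownV => //; apply: kw.
split; apply: known_mulmx => //; apply: known_block => //.
all: try exact: known_mx0.
all: try exact: known_mx1.
- exact/ku/kw.
- exact/ku.
by move=> a b; rewrite mxE; apply: knownN => //; rewrite mxE; apply: knownM.
Qed.

Lemma conj_expmx p (G H Y : 'M[A]_p) l :
  H *m G = 1%:M -> G *m H = 1%:M -> (G *m Y *m H) ^+ l = G *m Y ^+ l *m H.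
Proof.
move=> HG GH; elim: l => [|l IHl]; first by rewrite !expr0 mulmx1 GH.
rewrite (exprS (G *m Y *m H)) IHl (exprS Y) -!mulmxE !mulmxA.
by rewrite -(mulmxA _ H G) HG mulmx1.
Qed.

(* In the matrix with diagonal blocks [a : 'M_1] and [Y], first row [r] and
   first column [v], [r] contributes to the characteristic polynomial only
   through the [r Y^l v]. *)
Lemma pair_parameters_step p (Y : 'M[A]_(1 + p)) (v : 'cV[A]_(1 + p))
    (r : 'rV[A]_(1 + p)) (M : nat) :
    (M <= m.+1)%N ->
    (forall (Y : 'M[A]_p) (v : 'cV[A]_p) (r : 'rV[A]_p) (M : nat), (M <= m.+1)%N ->
      exists s : seq K, (size s <= m.+1 * (p * p + p))%N /\
      forall E, field_closed E -> (forall x, x \in s -> E x) ->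
        [/\ known_mx E m.+1 Y, known_mx E m.+1 v
          & (forall l, known_mx E M (r *m Y ^+ l *m v)) -> known_mx E M r]) ->
  exists s : seq K, (size s <= m.+1 * ((1 + p) * (1 + p) + (1 + p)))%N /\
    forall E, field_closed E -> (forall x, x \in s -> E x) ->
      [/\ known_mx E m.+1 Y, known_mx E m.+1 v
        & (forall l, known_mx E M (r *m Y ^+ l *m v)) -> known_mx E M r].
Proof.
move=> leM IHp.
have [v0|[d [w [i [ltd vE wu wge]]]]] := truncated_valuation v.
  (* For [v = 0] the products say nothing about [r], but [v] costs nothing and [r] takes its place
     in the count. *)
  exists (mx_coefs Y 0 m.+1 ++ mx_coefs r 0 m.+1); split.
    by rewrite size_cat !size_mx_coefs mul1n -mulnDl mulnC.
  move=> E clE /forall_cat[/mx_coefsP YE /mx_coefsP rE].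
  split=> [||_] => [a b s||a b s] lts; first by apply: YE.
    by rewrite v0; apply: known_mx0.
  by apply: rE; apply: leq_trans leM.
have [G [H [HG GH Ge kGH]]] := pivot_basis wu.
pose Y' := H *m Y *m G.
have YE : Y = G *m Y' *m H.
  by rewrite /Y' !mulmxA GH mul1mx -mulmxA GH mulmx1.
pose r' := r *m G.
have rE : r = r' *m H by rewrite /r' -mulmxA GH mulmx1.
have powE l : r *m Y ^+ l *m v = tau A d *: (r' *m Y' ^+ l *m col_mx 1%:M 0).
  rewrite YE conj_expmx // vE -scalemxAr; congr (_ *: _); rewrite -{1}Ge !mulmxA.
  by rewrite -(mulmxA _ H G) HG mulmx1.
have [s'' [les'' s''E]] := IHp (drsubmx Y') (dlsubmx Y') (rsubmx r') (M - d)%N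
  (leq_trans (leq_subr _ _) leM).
(* The [d] coefficients saved on each entry of [w] pay for those of [r'] between [M - d] and [M],
   which are out of reach of the products. *)
exists (mx_coefs w 0 (m.+1 - d) ++ mx_coefs (usubmx Y') 0 m.+1
  ++ mx_coefs r' (M - d) (minn d M) ++ s''); split.
  rewrite !size_cat !size_mx_coefs !mul1n muln1.
  have lemin : ((1 + p) * minn d M <= (1 + p) * d)%N.
    by rewrite leq_mul2l geq_minl orbT.
  apply: (@leq_trans ((1 + p) * (m.+1 - d)
    + ((1 + p) * m.+1 + ((1 + p) * d + m.+1 * (p * p + p))))%N).
    by rewrite !leq_add2l leq_add.
  rewrite addnCA [(_ + ((1 + p) * d + _))%N]addnA -mulnDr subnK; last exact: ltnW.
  by rewrite leq_eqVlt; apply/orP; left; apply/eqP; ring.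
move=> E clE /forall_cat[/mx_coefsP wE] /forall_cat[/mx_coefsP uE].
move=> /forall_cat[/mx_coefsP r'E] /s''E -/(_ clE)[kd kl kr].
have kw : known_mx E m.+1 w.
  move=> a b s _; have [lts|les] := ltnP s (m.+1 - d); first exact: wE.
  by rewrite ord1 wge // -(tcoef0 A 0); apply: (known0 _ clE (r := 1)).
have [kG kH] := kGH E clE kw.
have kY' : known_mx E m.+1 Y'.
  rewrite -(submxK Y'); apply: known_block => // a b s lts.
    by have := uE a (lshift p b) s lts; rewrite !mxE.
  by have := uE a (rshift 1 b) s lts; rewrite !mxE.
split=> [||kpow].
- by rewrite YE; do 2!apply: known_mulmx => //.
- by move=> a b; rewrite vE mxE; apply: knownM => //; apply: known_tau.
(* Divided by [t^d], the products are known to precision [M - d]; they yield the first entry of [r']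
   and the hypothesis of the recursion for the lower right block. *)
have [kx ky] : known_mx E (M - d) (lsubmx r')
    /\ forall l, known_mx E (M - d) (rsubmx r' *m drsubmx Y' ^+ l *m dlsubmx Y').
  apply: (@known_krylov_block _ _ _ _ clE _ _ (ulsubmx Y') (ursubmx Y')) => [|l a b].
    rewrite submxK => a b; apply: knownW (kY' a b).
    exact: leq_trans (leq_subr _ _) leM.
  rewrite hsubmxK submxK; apply: (@known_tauM _ _ _ _ M d) => //.
  by have := kpow l a b; rewrite powE mxE.
have kr' : known_mx E M r'.
  move=> a b s lts; have [ltsd|lesd] := ltnP s (M - d).
    rewrite -(hsubmxK r') mxE; case: splitP => b' _; first exact: kx.
    exact: kr.
  apply: r'E; rewrite lesd; suff -> : (M - d + minn d M = M)%N by [].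
  case: (leqP d M) => [ledM|/ltnW]; first by rewrite subnK.
  by rewrite -subn_eq0 => /eqP->.
rewrite rE; apply: known_mulmx => // a b; exact: knownW leM (kH a b).
Qed.

(** [Y] and [v] alone have [p * p + p] entries: the products stand in for all of [r]. The precision
    [M] is a variable because each step of the induction may lower it. *)
Lemma pair_parameters p (Y : 'M[A]_p) (v : 'cV[A]_p) (r : 'rV[A]_p) (M : nat) :
    (M <= m.+1)%N ->
  exists s : seq K, (size s <= m.+1 * (p * p + p))%N /\
    forall E, field_closed E -> (forall x, x \in s -> E x) ->
      [/\ known_mx E m.+1 Y, known_mx E m.+1 v
        & (forall l, known_mx E M (r *m Y ^+ l *m v)) -> known_mx E M r].
Proof.
elim: p Y v r M => [|p IHp] Y v r M leM; last exact: pair_parameters_step.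
by exists [::]; split=> // E _ _; split=> [[]|[]|_ ? []].
Qed.

(** The characteristic polynomial gives in turn the corner, the products [r *m adj_coef Y j *m v],
    the products [r *m Y ^+ l *m v], and from these the first row. *)
Lemma char_poly_parameters p (X : 'M[A]_p.+1) :
  exists s : seq K, (size s <= m.+1 * (p * p + p))%N /\
    forall E, field_closed E -> (forall x, x \in s -> E x) ->
      (forall l, known E m.+1 (char_poly X)`_l) -> known_mx E m.+1 X.
Proof.
move: (X : 'M[A]_(1 + p)) => {}X; pose Y := drsubmx X.
have [s [les sE]] := pair_parameters Y (dlsubmx X) (ursubmx X) (leqnn m.+1).
exists s; split=> // E clE Es; have {sE} [kY kv kr] := sE E clE Es.
rewrite -(submxK X) -/Y; set a := ulsubmx X; set r := ursubmx X in kr *.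
set v := dlsubmx X in kv kr * => kc; clearbody Y a r v.
pose knownP (q : {poly A}) := forall l, known E m.+1 q`_l.
have knownP0 : knownP 0 by move=> l; rewrite coef0; apply: known0.
have knownP1 : knownP 1.
  by move=> l; rewrite coef1; case: (l == _); [apply: known1|apply: known0].
have knownPD q q' : knownP q -> knownP q' -> knownP (q + q').
  by move=> kq kq' l; rewrite coefD; apply: knownD.
have knownPM q q' : knownP q -> knownP q' -> knownP (q * q').
  by move=> kq kq' l; rewrite coefM; apply: known_sum => // j _; apply: knownM.
have kchi : knownP (char_poly Y).
  apply: (big_ind knownP knownP0 knownPD) => g _; apply: (knownPM).
    rewrite -signr_odd; case: (odd _) => //.
    by move=> l; rewrite expr1 coefN; apply: knownN => //; apply: knownP1.
  apply: (big_ind knownP knownP1 knownPM) => b _ l; rewrite !mxE coefB coefC.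
  apply: knownB => //; last by case: eqP => _; [apply: kY|apply: known0].
  rewrite coefMn coefX; case: (b == _); last exact: known0.
  by case: (l == _); [apply: known1|apply: known0].
(* In degree [p] the adjugate term vanishes, and [a] is the only unknown. *)
have ka : known E m.+1 (a 0 0).
  have := kc p; rewrite char_poly_bordered adj_coef_ge // mulmx0 mul0mx mxE subr0.
  rewrite mulrBl coefB coefCM.
  have -> : (char_poly Y)`_p = 1.
    by have /monicP := char_poly_monic Y; rewrite /lead_coef size_char_poly.
  rewrite mulr1 => kp; rewrite -[a 0 0](subKr ('X * char_poly Y)`_p).
  apply: knownB => //; rewrite coefXM; case: eqP => // _; exact: known0.
have kadj j : known_mx E m.+1 (r *m adj_coef Y j *m v).
  move=> x y; rewrite !ord1; have := kc j; rewrite char_poly_bordered => kj.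
  rewrite -[X in known _ _ X](subKr (('X - (a 0 0)%:P) * char_poly Y)`_j).
  apply: knownB => //; apply: knownPM => //= l; rewrite coefB coefX coefC.
  apply: knownB => //; first by case: (l == _); [apply: known1|apply: known0].
  by case: eqP => _; [apply: ka|apply: known0].
(* The recursion for [adj_coef] passes from [Y ^+ l] to [Y ^+ l.+1], and [adj_coef Y p.-1 = 1]
   extracts the wanted product. For [p = 0] that product is an empty sum. *)
have kpow l : known_mx E m.+1 (r *m Y ^+ l *m v)
    /\ forall j, known_mx E m.+1 (r *m Y ^+ l *m adj_coef Y j *m v).
  have last_known l' :
      (forall j, known_mx E m.+1 (r *m Y ^+ l' *m adj_coef Y j *m v))
      -> known_mx E m.+1 (r *m Y ^+ l' *m v).
    case: (posnP p) => [p0 _|p0 /(_ p.-1)]; last by rewrite adj_coef_last // mulmx1.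
    move=> x y; rewrite mxE; apply: known_sum => // j.
    by have := leq_trans (ltn_ord j) (eq_leq p0).
  elim: l => [|l [kl kjl]]; first by split; [apply: last_known|] => j;
    rewrite expr0 mulmx1; apply: kadj.
  suff kS j : known_mx E m.+1 (r *m Y ^+ l.+1 *m adj_coef Y j *m v).
    by split=> //; apply: last_known.
  rewrite (exprSr Y) -mulmxE mulmxA -(mulmxA (r *m _)) adj_coef_rec.
  rewrite mulmxBr mulmxBl; apply: known_mxB => //.
    by case: j => [|j] //; rewrite mulmx0 mul0mx; apply: known_mx0.
  by rewrite mul_mx_scalar -scalemxAl => x y; rewrite mxE; apply: knownM.
have ka' : known_mx E m.+1 a by move=> x y; rewrite !ord1.
have kr' : known_mx E m.+1 r by apply: kr => l; have [] := kpow l.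
exact: known_block ka' kr' kv kY.
Qed.

End MatrixParameters.

Lemma jet_gl_fiber_power_chain_le (k : fieldType) (p i m d : nat) :
  prime_chain (jet_scheme m (gl_fiber_power k p.+1 i)) d ->
  (d <= m.+1 * (p.+1 + i * (p * p + p)))%N.
Proof.
apply: prime_chain_le => K phi w wX.
have [w' w'E] := @jet_coords_surj _ m K w.
have : is_point (jet_scheme m (gl_fiber_power k p.+1 i)) phi (jet_coords w').
  by move=> f fX; rewrite (eq_ev (v' := w) (phi' := phi)) //; apply: wX.
move=> /jet_schemeP/gl_fiber_powerP charE {wX}.
have [S SP] := fin_all_exists (fun j : 'I_i =>
  char_poly_parameters (A := qpoly_truncated K m)
    (\matrix_(a, b) w' (inr (j, (a, b))))).
pose Y := \row_y w' (inl y).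
exists (mx_coefs (A := qpoly_truncated K m) Y 0 m.+1
  ++ flatten [seq S j | j <- enum 'I_i]); split.
  rewrite size_cat size_mx_coefs mul1n mulnDr mulnC leq_add2l size_flatten.
  rewrite /shape -map_comp sumnE big_map big_enum /=.
  rewrite mulnCA -[i in (_ <= i * _)%N]card_ord -sum_nat_const.
  by apply: leq_sum => j _; case: (SP j).
move=> E clE Ek /forall_cat[/mx_coefsP YE SE] t.
have kY y : known (A := qpoly_truncated K m) E m.+1 (w' (inl y)).
  by move=> s lts; have := YE 0 y s lts; rewrite mxE.
rewrite -w'E; case: t => -[y|[j [a b]]] s; first exact/kY/ltn_ord.
have [_ /(_ E clE) kX] := SP j; rewrite /jet_coords /=.
have /(_ _ _)/(_ a b s (ltn_ord s)) := kX; rewrite mxE; apply.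
  move=> x xS; apply: SE; apply/flattenP; exists (S j) => //.
  by apply: map_f; rewrite mem_enum.
move=> l; rewrite charE coefD coefXn coef_sum; apply: knownD => //.
  by case: (l == _); [apply: known1|apply: known0].
apply: known_sum => // y _; rewrite coefZ coefXn; apply: knownM => //.
by case: (l == _); [apply: known1|apply: known0].
Qed.

(** * A rational parametrisation of the fiber power *)

Section KernelPrime.
Variables (k : comNzRingType) (T : finType) (K : fieldType).
Variables (phi : {rmorphism k -> K}) (w : T -> K).

Definition point_ideal : {pred fpoly k T} := fun f => ev phi w f == 0.

Lemma point_ideal_idealr : idealr_closed point_ideal.
Proof.
split=> [||a f g]; rewrite -!topredE /= /point_ideal ?rmorph0 ?rmorph1 ?oner_eq0 //.
by move=> /eqP f0 /eqP g0; rewrite rmorphD rmorphM /= f0 g0 mulr0 addr0.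
Qed.

Lemma point_ideal_prime : prime_idealr_closed point_ideal.
Proof. by move=> f g; rewrite -!topredE /= /point_ideal rmorphM /= mulf_eq0. Qed.

Lemma prime_chain0 (X : affine_scheme k T) : is_point X phi w -> prime_chain X 0.
Proof.
move=> wX; exists (fun=> point_ideal); split=> [_|a b]; last by rewrite !ord1.
split; [exact: point_ideal_idealr|exact: point_ideal_prime|].
by move=> f /wX f0; apply/eqP.
Qed.

End KernelPrime.

(** Specialisation of rational functions is a relation on [K], not a ring morphism; this carries it
    through polynomial expressions. *)
Lemma ev_rel (k : comNzRingType) (T : finType) (B C : comNzRingType)
    (phi : {rmorphism k -> B}) (psi : {rmorphism k -> C}) (v : T -> B) (w : T -> C)
    (R : B -> C -> Prop) :
    (forall c, R (phi c) (psi c)) ->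
    (forall x y x' y', R x y -> R x' y' -> R (x + x') (y + y')) ->
    (forall x y x' y', R x y -> R x' y' -> R (x * x') (y * y')) ->
    (forall t, R (v t) (w t)) ->
  forall f, R (ev phi v f) (ev psi w f).
Proof.
move=> RC RD RM Rv f; rewrite /ev /mmap.
have R0 : R 0 0 by have := RC 0; rewrite !rmorph0.
have R1 : R 1 1 by have := RC 1; rewrite !rmorph1.
apply: (big_ind2 R) => // m _; apply: (RM) => //.
rewrite /mmap1; apply: (big_ind2 R) => // l _.
by elim: (m l) => [|e IHe]; rewrite ?expr0 // !exprS; apply: RM => //; apply: Rv.
Qed.

Section RationalChain.
Variables (k : fieldType) (T Z : finType) (X : affine_scheme k T).
Local Notation B := {mpoly k[#|Z|]}.
Variables (K : fieldType) (iota : {rmorphism B -> K}).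
Hypothesis iota_eq0 : forall f, (iota f == 0) = (f == 0).
Variables (num den : T -> B) (b : Z -> k) (tauz : Z -> T).
Let phi : {rmorphism k -> K} := iota \o @mpolyC #|Z| k.
Let evb : {rmorphism B -> k} := ev idfun b.

Hypothesis den_b : forall t, evb (den t) != 0.
Hypothesis num_tau : forall z, num (tauz z) = var k z.
Hypothesis den_tau : forall z, den (tauz z) = 1.
Hypothesis genericX : is_point X phi (fun t => iota (num t) / iota (den t)).

Let spz (a : nat) (z : Z) : B := if (enum_rank z < a)%N then (b z)%:MP else var k z.
Let sp (a : nat) : {rmorphism B -> B} := ev (@mpolyC #|Z| k) (spz a).
Let w (a : nat) (t : T) : K := iota (sp a (num t)) / iota (sp a (den t)).

Let spC a c : sp a c%:MP = c%:MP.
Proof. by rewrite /sp /= /ev mmapC. Qed.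

Let sp_var a z : sp a (var k z) = spz a z.
Proof. exact: ev_var. Qed.

Let sp0 f : sp 0 f = f.
Proof. by rewrite -[RHS]ev_id; apply: eq_ev. Qed.

Let evb_sp a f : evb (sp a f) = evb f.
Proof.
have -> : evb (sp a f) = ev (evb \o @mpolyC #|Z| k) (evb \o spz a) f.
  exact: ev_comp.
apply: eq_ev => [c|z] /=; first by rewrite /evb /= /ev mmapC.
by rewrite /spz; case: ifP => _; rewrite /evb /= ?ev_var // /ev mmapC.
Qed.

Let sp_sp a c f : (a <= c)%N -> sp c (sp a f) = sp c f.
Proof.
move=> leac.
have -> : sp c (sp a f) = ev (sp c \o @mpolyC #|Z| k) (sp c \o spz a) f.
  exact: ev_comp.
apply: eq_ev => [x|z] /=; first exact: spC.
rewrite [spz a z]/spz; case: (boolP (_ < a)%N) => [lta|_]; last exact: sp_var.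
by rewrite spC /spz (leq_trans lta).
Qed.

(* [spec c x y]: the rational function [x] is regular at the point [b], and
   [y] is its restriction to the subspace on which the first [c] coordinates
   are those of [b]. *)
Let spec (c : nat) (x y : K) : Prop := exists f g : B,
  [/\ evb g != 0, x = iota f / iota g & y = iota (sp c f) / iota (sp c g)].

Let frac_neq0 c (g : B) : evb g != 0 -> iota (sp c g) != 0 :> K.
Proof.
rewrite iota_eq0 -(evb_sp c); apply: contraNneq => ->.
by rewrite rmorph0.
Qed.

Let frac_neq0' (g : B) : evb g != 0 -> iota g != 0 :> K.
Proof. by move/(frac_neq0 0); rewrite sp0. Qed.

Let specD c x y x' y' : spec c x y -> spec c x' y' -> spec c (x + x') (y + y').
Proof.
move=> [f [g [g0 -> ->]]] [f' [g' [g'0 -> ->]]].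
exists (f * g' + f' * g), (g * g'); rewrite !rmorphD !rmorphM /= mulf_neq0 //.
by split=> //; rewrite addf_div ?frac_neq0 ?frac_neq0'.
Qed.

Let specM c x y x' y' : spec c x y -> spec c x' y' -> spec c (x * x') (y * y').
Proof.
move=> [f [g [g0 -> ->]]] [f' [g' [g'0 -> ->]]].
exists (f * f'), (g * g'); rewrite !rmorphM /= mulf_neq0 //.
by split=> //; rewrite mulf_div.
Qed.

Let specC c x : spec c (phi x) (phi x).
Proof. by exists x%:MP, 1; rewrite spC !rmorph1 !divr1 oner_eq0. Qed.

Let spec_w a c t : (a <= c)%N -> spec c (w a t) (w c t).
Proof.
move=> leac; exists (sp a (num t)), (sp a (den t)).
split; [|exact: erefl|].
  rewrite evb_sp; exact: den_b.
exact: (congr2 (fun x y => iota x / iota y)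
  (esym (sp_sp (num t) leac)) (esym (sp_sp (den t) leac))).
Qed.

Let spec_ev a c f : (a <= c)%N -> spec c (ev phi (w a) f) (ev phi (w c) f).
Proof.
move=> leac; apply: ev_rel => [x|x y x' y'|x y x' y'|t].
- exact: specC.
- exact: specD.
- exact: specM.
exact: spec_w.
Qed.

Let spec0 c y : spec c 0 y -> y = 0.
Proof.
move=> [f [g [g0 /esym/eqP]]].
rewrite mulf_eq0 invr_eq0 (negPf (frac_neq0' g0)) orbF.
by rewrite iota_eq0 => /eqP-> ->; rewrite !rmorph0 mul0r.
Qed.

Let point_w c : is_point X phi (w c).
Proof.
move=> f fX; apply: (spec0 (c := c)).
have -> : 0 = ev phi (w 0) f; last exact: spec_ev.
rewrite -(genericX fX); apply: eq_ev => // t.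
by rewrite /w !sp0.
Qed.

(** The primes are the ideals of the images of the subspaces on which more and more coordinates are
    fixed at [b]; the denominators do not vanish at [b], so each restriction makes sense. *)
Lemma prime_chain_rational : prime_chain X #|Z|.
Proof.
exists (fun a => point_ideal phi (w a)); split=> [a|a c ltac].
  split; [exact: point_ideal_idealr|exact: point_ideal_prime|].
  by move=> f /point_w f0; apply/eqP.
split=> [f /eqP f0|].
  by apply/eqP/(spec0 (c := c)); rewrite -f0; apply/spec_ev/ltnW.
have lta : (a < #|Z|)%N by rewrite (leq_trans ltac) // -ltnS.
pose z := enum_val (Ordinal lta : 'I_#|Z|).
(* The coordinate [tauz z] of the parametrised point is the parameter [z] itself, so this function
   vanishes once [z] is fixed and not before. *)
exists (var k (tauz z) - (b z)%:MP).
all: rewrite -topredE /= /point_ideal rmorphB /= ev_var [ev _ _ _%:MP]mmapC /w.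
all: rewrite num_tau den_tau !rmorph1 divr1 sp_var /spz enum_valK /=.
  by rewrite ltac subrr.
rewrite ltnn -rmorphB iota_eq0; apply/eqP.
move=> /(congr1 (ev idfun (fun z => b z + 1))).
rewrite rmorphB rmorph0 /= ev_var [ev _ _ _%:MP]mmapC addrAC subrr add0r => /eqP.
by rewrite oner_eq0.
Qed.

End RationalChain.

(** * Recovering the last row from the characteristic polynomial *)

Section LastRow.
Variables (R : comNzRingType) (p : nat).
Implicit Types (zeta : 'I_p * 'I_p.+1 -> R) (rho c : 'rV[R]_p.+1).

Definition with_last_row zeta rho : 'M[R]_p.+1 :=
  \matrix_(a, b) if unlift ord_max a is Some a' then zeta (a', b) else rho 0 b.

(** Cofactors along the last row do not involve that row, which is therefore set to 0. *)
Definition last_cofactor zeta (b : 'I_p.+1) : {poly R} :=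
  cofactor (char_poly_mx (with_last_row zeta 0)) ord_max b.

Definition cofactor_mx zeta : 'M[R]_p.+1 :=
  \matrix_(b, y) (last_cofactor zeta b)`_y.

Definition cofactor_row zeta : 'rV[R]_p.+1 :=
  \row_y ('X * last_cofactor zeta ord_max)`_y.

(** Expansion along the last row, in which the characteristic polynomial is affine. *)
Lemma char_poly_with_last_row zeta rho (y : 'I_p.+1) :
  (char_poly (with_last_row zeta rho))`_y
  = (cofactor_row zeta - rho *m cofactor_mx zeta) 0 y.
Proof.
have cofE b : cofactor (char_poly_mx (with_last_row zeta rho)) ord_max b
    = last_cofactor zeta b.
  rewrite /last_cofactor /cofactor; congr (_ * \det _).
  by apply/matrixP => a d; rewrite !mxE liftK.
rewrite /char_poly (expand_det_row _ ord_max) !mxE.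
rewrite (eq_bigr (fun b => ('X *+ (ord_max == b) * last_cofactor zeta b)
    - (rho 0 b)%:P * last_cofactor zeta b)); last first.
  by move=> b _; rewrite cofE !mxE unlift_none mulrBl.
rewrite sumrB coefB (bigD1 ord_max) //= eqxx mulr1n big1 ?addr0; last first.
  by move=> b; rewrite eq_sym => /negPf->; rewrite mulr0n mul0r.
by congr (_ - _); rewrite coef_sum; apply: eq_bigr => b _; rewrite coefCM mxE.
Qed.

Lemma eq_cofactor_mx zeta zeta' :
  zeta =1 zeta' -> cofactor_mx zeta = cofactor_mx zeta'.
Proof.
move=> eqz; apply/matrixP => b y; rewrite !mxE /last_cofactor.
suff -> : with_last_row zeta 0 = with_last_row zeta' 0 by [].
by apply/matrixP => a d; rewrite !mxE; case: unlift.
Qed.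

End LastRow.

Section LastRowMap.
Variables (R S : comNzRingType) (f : {rmorphism R -> S}) (p : nat).
Variable zeta : 'I_p * 'I_p.+1 -> R.

Lemma map_last_cofactor b :
  map_poly f (last_cofactor zeta b) = last_cofactor (f \o zeta) b.
Proof.
rewrite -cofactor_map_mx map_char_poly_mx; congr (cofactor (char_poly_mx _) _ _).
apply/matrixP => a d; rewrite !mxE.
by case: unliftP => [a' _|_] //; rewrite ?mxE rmorph0.
Qed.

Lemma map_cofactor_mx : map_mx f (cofactor_mx zeta) = cofactor_mx (f \o zeta).
Proof. by apply/matrixP => a d; rewrite !mxE -map_last_cofactor coef_map. Qed.

Lemma map_cofactor_row : map_mx f (cofactor_row zeta) = cofactor_row (f \o zeta).
Proof.
apply/matrixP => a d; rewrite !mxE -map_last_cofactor !coefXM.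
by case: ifP => _; rewrite ?rmorph0 ?coef_map.
Qed.

End LastRowMap.

(** The size is a variable [d], so that it need not be [(size q).-1] by definition. *)
Lemma char_poly_companion (R : comNzRingType) (q : {poly R}) d (M : 'M[R]_d) :
    q \is monic -> d = (size q).-1 ->
    (forall a b : 'I_d, M a b =
       if a == d.-1 :> nat then - q`_b else (a.+1 == b :> nat)%:R) ->
  char_poly M = q.
Proof.
move=> q_monic dE; move: M; rewrite dE => M ME.
rewrite -[RHS]companionmxK //; congr char_poly.
by apply/matrixP => a b; rewrite ME mxE.
Qed.

(* Companion matrices realise every characteristic polynomial, so the linear
   system for the last row is surjective. *)
Lemma det_cofactor_mx_companion (k : fieldType) (p : nat) :
  \det (cofactor_mx (fun z : 'I_p * 'I_p.+1 => (z.1.+1 == z.2)%:R : k)) != 0.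
Proof.
set zeta := fun z => _.
have solve (c : 'rV[k]_p.+1) : exists rho, rho *m cofactor_mx zeta == c.
  (* By [char_poly_with_last_row], these are the coefficients forced by
     [rho *m cofactor_mx zeta = c]; the last row of the companion matrix of [q] realises them. *)
  pose q : {poly k} := 'X^(p.+1)
    + \poly_(y < p.+1) (cofactor_row zeta - c) 0 (inord y).
  have szq : size q = p.+2.
    by rewrite size_polyDl size_polyXn // ltnS size_poly.
  have q_monic : q \is monic.
    by rewrite monicE lead_coefDl ?lead_coefXn // size_polyXn ltnS size_poly.
  pose rho : 'rV[k]_p.+1 := \row_b - q`_b.
  exists rho; apply/eqP/rowP => y.
  have : (char_poly (with_last_row zeta rho))`_y = q`_y.
    congr ((polyseq _)`_y); apply: char_poly_companion => //; first by rewrite szq.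
    move=> a b; rewrite mxE; case: unliftP => [a' ->|->].
      by rewrite lift_max ltn_eqF.
    by rewrite eqxx mxE.
  rewrite char_poly_with_last_row coefD coefXn ltn_eqF // add0r coef_poly ltn_ord.
  by rewrite inord_val !mxE => /addrI/oppr_inj.
pose M : 'M[k]_p.+1 := \matrix_y xchoose (solve (delta_mx 0 y)).
have MQ : M *m cofactor_mx zeta = 1%:M.
  apply/row_matrixP => y; rewrite row_mul rowK rowE mulmx1.
  exact/eqP/(xchooseP (solve _)).
by have := mulmx1_unit MQ => -[_]; rewrite unitmxE unitfE.
Qed.

(** The parameters are the coefficients of the polynomial and the first [p] rows of each matrix;
    Cramer's rule gives the last rows, with denominators [\det (cofactor_mx _)]. *)
Lemma gl_fiber_power_prime_chain (k : fieldType) (p i : nat) :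
  prime_chain (gl_fiber_power k p.+1 i) (p.+1 + i * (p * p.+1)).
Proof.
pose Z : finType := ('I_p.+1 + 'I_i * ('I_p * 'I_p.+1))%type.
have -> : (p.+1 + i * (p * p.+1))%N = #|Z|.
  by rewrite card_sum !card_prod !card_ord.
pose B := {mpoly k[#|Z|]}.
pose zeta j (z : 'I_p * 'I_p.+1) : B := var k (inr (j, z) : Z).
pose y_row : 'rV[B]_p.+1 := \row_y var k (inl y : Z).
pose num (t : 'I_p.+1 + 'I_i * ('I_p.+1 * 'I_p.+1)) : B := match t with
  | inl y => var k (inl y : Z)
  | inr (j, (a, b)) =>
      if unlift ord_max a is Some a' then var k (inr (j, (a', b)) : Z)
      else ((cofactor_row (zeta j) - y_row) *m \adj (cofactor_mx (zeta j))) 0 b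
  end.
pose den (t : 'I_p.+1 + 'I_i * ('I_p.+1 * 'I_p.+1)) : B := match t with
  | inl y => 1
  | inr (j, (a, b)) => if unlift ord_max a is Some a' then 1
      else \det (cofactor_mx (zeta j))
  end.
(* The rows have companion shape, where the denominators are nonzero. *)
pose base (z : Z) : k := match z with
  | inl _ => 0
  | inr (_, z) => (z.1.+1 == z.2 :> nat)%:R
  end.
pose tauz (z : Z) : 'I_p.+1 + 'I_i * ('I_p.+1 * 'I_p.+1) := match z with
  | inl y => inl y
  | inr (j, (a, b)) => inr (j, (lift ord_max a, b))
  end.
have det_base j : ev idfun base (\det (cofactor_mx (zeta j))) != 0.
  rewrite -det_map_mx map_cofactor_mx; set M := cofactor_mx _.
  suff -> : M = cofactor_mx
      (fun z : 'I_p * 'I_p.+1 => (z.1.+1 == z.2 :> nat)%:R : k).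
    exact: det_cofactor_mx_companion.
  by apply: eq_cofactor_mx => z; rewrite /= ev_var.
have [K [iota iota0]] : exists (K : fieldType) (iota : {rmorphism B -> K}),
    forall f, (iota f == 0) = (f == 0).
  by exists {fraction B}, (@tofrac B) => f; apply: tofrac_eq0.
apply: (@prime_chain_rational k _ Z _ K iota iota0 num den base tauz).
- move=> [y|[j [a b]]] /=; first by rewrite rmorph1 oner_eq0.
  by case: unlift => [a'|]; rewrite ?rmorph1 ?oner_eq0.
- by move=> [y|[j [a b]]] //=; rewrite liftK.
- by move=> [y|[j [a b]]] //=; rewrite liftK.
apply/fiber_powerP => j y; rewrite chevalleyP /= rmorph1 divr1.
set Q := cofactor_mx (zeta j); set N := cofactor_row (zeta j).
have detQ : iota (\det Q) != 0.
  rewrite iota0; apply: contraNneq (det_base j) => ->.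
  by rewrite rmorph0.
pose rho : 'rV[K]_p.+1 := (iota (\det Q))^-1 *: map_mx iota ((N - y_row) *m \adj Q).
rewrite (_ : \matrix_(a, b) _ = with_last_row (iota \o zeta j) rho); last first.
  apply/matrixP => a b; rewrite mxE [RHS]mxE /=; case: unlift => [a'|].
    by rewrite rmorph1 divr1.
  by rewrite [RHS]mxE mulrC; congr (_ * _); rewrite [RHS]mxE.
rewrite char_poly_with_last_row -map_cofactor_mx -map_cofactor_row -scalemxAl.
rewrite -map_mxM -mulmxA mul_adj_mx mul_mx_scalar map_mxZ scalerA mulVf // scale1r.
by rewrite map_mxB opprB addrC subrK !mxE.
Qed.

(** * Existence of the dimensions and conclusion *)

Lemma prime_chain_le_card (k : fieldType) (T : finType) (X : affine_scheme k T) d :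
  prime_chain X d -> (d <= #|T|)%N.
Proof.
apply: prime_chain_le => K phi w _; exists (codom w); rewrite size_codom.
by split=> // E _ _ Ew t; apply/Ew/codom_f.
Qed.

(** The zero jet is a point, since zero matrices have characteristic polynomial ['X^n]. *)
Lemma jet_gl_fiber_power_nonempty (k : fieldType) (n i m : nat) :
  prime_chain (jet_scheme m (gl_fiber_power k n i)) 0.
Proof.
apply: (@prime_chain0 _ _ k idfun (fun=> 0)) => f fX.
pose w0 (t : 'I_n + 'I_i * ('I_n * 'I_n)) : {poly %/ ('X^(m.+1) : {poly k})} := 0.
rewrite (eq_ev (phi' := idfun) (v' := jet_coords w0)) //; last first.
  by move=> t; rewrite /jet_coords coef0.
suff /jet_schemeP : is_point (gl_fiber_power k n i) (jet_algebra_map m idfun) w0.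
  exact.
apply/gl_fiber_powerP => j; rewrite [X in _ + X]big1 ?addr0; last first.
  by move=> y _; rewrite scale0r.
rewrite (_ : \matrix_(a, b) _ = 0); last by apply/matrixP => a b; rewrite !mxE.
by rewrite /char_poly /char_poly_mx map_mx0 subr0 det_scalar.
Qed.

(** Excluded middle decides whether a longer chain exists; passing to it decreases [b - d0]. *)
Lemma has_dim_exists (k : comNzRingType) (T : finType) (X : affine_scheme k T) d0 b :
    prime_chain X d0 -> (forall d, prime_chain X d -> (d <= b)%N) ->
  exists2 d, has_dim X d & (d0 <= d <= b)%N.
Proof.
move=> chain0 leb; have [n] := ubnP (b - d0)%N.
elim: n d0 chain0 => // n IHn d0 chain0; rewrite ltnS => len.
have [[d [chaind ltd]]|nex] :=
  excluded_middle_informative (exists d, prime_chain X d /\ (d0 < d)%N).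
  have [|d' dimd' /andP[led' led'b]] := IHn d chaind.
    apply: leq_trans len; rewrite ltn_sub2l // (leq_trans ltd) //; exact: leb.
  by exists d' => //; rewrite led'b andbT (leq_trans (ltnW ltd)).
exists d0; last by rewrite leqnn leb.
by split=> // d chaind; rewrite leqNgt; apply/negP => ltd; apply: nex; exists d.
Qed.

Theorem theoremC (F : finFieldType) (n : nat) (hn : (1 <= n)%N) (i : nat) :
  exists C : nat, forall m : nat, exists d e : nat,
    [/\ has_dim (jet_scheme m (gl_fiber_power F n i)) d,
        has_dim (gl_fiber_power F n i) e
      & (d < m * e + C)%N].
Proof.
case: n hn => // p _.
(* [D] bounds [e] from below and [m.+1 * D] bounds [d] from above, so
   [d <= m * D + D < m * e + D.+1]. *)
pose D := (p.+1 + i * (p * p + p))%N.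
exists D.+1 => m.
have [d dimd /andP[_ led]] :=
  has_dim_exists (jet_gl_fiber_power_nonempty F p.+1 i m)
  (@jet_gl_fiber_power_chain_le F p i m).
have [e dime /andP[lee _]] :=
  has_dim_exists (gl_fiber_power_prime_chain F p i)
  (@prime_chain_le_card F _ (gl_fiber_power F p.+1 i)).
exists d, e; split=> //.
apply: leq_ltn_trans led _; rewrite mulSn addnC addnS ltnS leq_add2r.
by rewrite leq_mul2l (leq_trans _ lee) ?orbT // mulnS [(p + _)%N]addnC.
Qed.
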